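(* For all integers $m,n\ge 1$ and every $1\le p\le\infty$, $$c^{\mathrm{conc}}_{p,m,n}=c^{\mathrm{lin}}_{p,m,n}.$$ Equivalently, for every concave function $f:[0,\infty)\to[0,\infty)$ and all $A_1,\dots,A_m\in M_n(\mathbb C)$, $$\left\|f\left(\left|\sum_{j=1}^m A_j\right|\right)\right\|_p\le c^{\mathrm{lin}}_{p,m,n}\left\|\sum_{j=1}^m f(|A_j|)\right\|_p,$$ and the constant $c^{\mathrm{lin}}_{p,m,n}$ is best possible (it cannot be replaced by a smaller constant valid for all such $f$ and $A_1,\dots,A_m$).
   Context: $M_n(\mathbb C)$ is the set of complex $n\times n$ matrices, $|A|=(A^*A)^{1/2}$, $\|A\|_p=(\operatorname{Tr}|A|^p)^{1/p}$ for $1\le p<\infty$, and $\|A\|_\infty$ is the operator norm. For positive semidefinite $P$, $f(P)$ is defined by the spectral functional calculus ($f$ applied to all eigenvalues of $P$, including the eigenvalue $0$). For $1\le p\le\infty$ and integers $m,n\ge1$ define $$c^{\mathrm{lin}}_{p,m,n}:=\sup_{A_1,\dots,A_m\in M_n(\mathbb C)}\frac{\left\|\sum_{j=1}^mA_j\right\|_p}{\left\|\sum_{j=1}^m|A_j|\right\|_p},\qquad c^{\mathrm{conc}}_{p,m,n}:=\sup_{f,\,A_1,\dots,A_m}\frac{\left\|f\left(\left|\sum_{j=1}^mA_j\right|\right)\right\|_p}{\left\|\sum_{j=1}^mf(|A_j|)\right\|_p},$$ where the second supremum is over all concave functions $f:[0,\infty)\to[0,\infty)$ and all $A_1,\dots,A_m\in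 M_n(\mathbb C)$, and in both suprema the cases with zero denominator are excluded. *)

(* Defs.v *)
From HB Require Import structures.
From mathcomp Require Import all_boot all_order all_algebra.
From mathcomp Require Import all_classical all_reals all_analysis.
From mathcomp Require Import sesquilinear spectral complex.

Set Implicit Arguments.
Unset Strict Implicit.
Unset Printing Implicit Defensive.

Import Order.TTheory GRing.Theory Num.Theory.
Import numFieldNormedType.Exports.

Local Open Scope classical_set_scope.
Local Open Scope ring_scope.
Local Open Scope complex_scope.
Local Open Scope sesquilinear_scope.

Section Definitions.
Context {R : realType}.

(* Meaningful for hermitian P only: for these [spectral_diag P] lists the
   eigenvalues of P with multiplicity, as complex numbers with zero imaginary
   part, and [P = invmx (spectralmx P) *m diag_mx (spectral_diag P) *m
   spectralmx P] with [spectralmx P] unitary. *)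
Definition funcalc n (f : R -> R) (P : 'M[R[i]]_n) : 'M[R[i]]_n :=
  invmx (spectralmx P) *m
    diag_mx (map_mx (fun z : R[i] => (f (complex.Re z))%:C) (spectral_diag P)) *m
    spectralmx P.

Definition mxabs n (A : 'M[R[i]]_n) : 'M[R[i]]_n :=
  funcalc (@Num.sqrt R) (A ^t* *m A).

Definition l2norm n (x : 'cV[R[i]]_n) : R :=
  Num.sqrt (complex.Re ((x ^t* *m x) 0 0)).

Definition opnorm n (A : 'M[R[i]]_n) : R :=
  sup [set l2norm (A *m x) | x in [set x : 'cV[R[i]]_n | l2norm x <= 1]].

(* Only used for 1 <= p; the value at p = -oo is junk. *)
Definition schatten n (p : \bar R) (A : 'M[R[i]]_n) : R :=
  match p with
  | r%:E => complex.Re (\tr (funcalc (fun x => x `^ r) (mxabs A))) `^ r^-1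
  | +oo%E => opnorm A
  | -oo%E => 0
  end.

(* Concave functions [0,+oo) -> [0,+oo); values of f at negative arguments
   are irrelevant, and f may be discontinuous at 0. *)
Definition concave_nneg (f : R -> R) : Prop :=
  (forall x, 0 <= x -> 0 <= f x) /\
  convex_function (`[0, +oo[ : set R^o) (fun x => - f x).

Definition c_lin (p : \bar R) (m n : nat) : \bar R :=
  ereal_sup [set (schatten p (\sum_j A j) /
                  schatten p (\sum_j mxabs (A j)))%:E
            | A in [set A : 'I_m -> 'M[R[i]]_n |
                    schatten p (\sum_j mxabs (A j)) != 0]].

Definition c_conc (p : \bar R) (m n : nat) : \bar R :=
  ereal_sup [set (schatten p (funcalc fA.1 (mxabs (\sum_j fA.2 j))) /
                  schatten p (\sum_j funcalc fA.1 (mxabs (fA.2 j))))%:E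
            | fA in [set fA : (R -> R) * ('I_m -> 'M[R[i]]_n) |
                     concave_nneg fA.1 /\
                     schatten p (\sum_j funcalc fA.1 (mxabs (fA.2 j))) != 0]].

End Definitions.

(* Main.v *)
Require Import Defs.
From HB Require Import structures.
From mathcomp Require Import all_boot all_order all_algebra.
From mathcomp Require Import all_classical all_reals all_analysis.
From mathcomp Require Import sesquilinear spectral complex.
From mathcomp Require Import ring lra.

(** Write X_j = |A_j|, S = sum_j A_j, and let c be the linear constant.  Since
    f = id is concave, c_lin <= c_conc and c is best possible; the content is
    the inequality for concave f.

    For p = +oo let sigma be the top singular value of S.  If some X_j has an
    eigenvalue >= sigma, then ||sum_j f(X_j)|| >= f(sigma) already.  Otherwise
    f(X_j) >= (f(sigma) / sigma) X_j for every j, and the linear inequality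
    concludes ([concave_bound_inf]).

    For p < +oo two steps are combined.

    Step 1 is the case of a truncation f(t) = min(t, s) ([cut_bound]).  Let
    P_j be the spectral projection of X_j for ]s, +oo[, and Q the projection on
    the join of their ranges.  Let K be a contraction with
    K S (1 - Q) = |S (1 - Q)|.  The matrices
      B_j = s P_j + (1 - Q) K A_j (1 - P_j)
    satisfy |B_j| <= min(X_j, s), so the linear inequality bounds
    ||sum_j B_j||_p by c ||sum_j min(X_j, s)||_p.  On the other hand sum_j B_j
    is block triangular for Q, with diagonal blocks s sum_j P_j and
    |S (1 - Q)|.  The first has rank Q and trace at least s rank(Q), so its
    p-th power sum is at least s^p rank(Q); and by interlacing, S has at most
    rank(Q) more singular values above any level than S (1 - Q).  Hence
    ||sum_j B_j||_p >= ||min(|S|, s)||_p.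

    Step 2 recovers f.  The function u |-> f(u^(1/p))^p is again concave, so on
    the finitely many eigenvalues that occur
      f(t)^p = f(0)^p + sum_i c_i min(t, s_i)^p   with c_i >= 0
    ([concave_decomposition]).  The left side ||f(|S|)||_p^p splits
    accordingly, and Step 1 applies to each piece.  The right sides are put
    back together by a noncommutative Minkowski inequality: if
    h^p = sum_i h_i^p on the spectra, then
      sum_i Tr (sum_j h_i(X_j))^p <= Tr (sum_j h(X_j))^p
    ([trp_superadditive]).  This is the commuting case of the concavity of
    A |-> Tr (K^* A^(1/p) K)^p.  It follows from Young's inequality
    p Tr (T Y^(1-1/p)) <= Tr T^p + (p - 1) Tr Y and from the operator concavity
    of the power 1 - 1/p ([power_superadditive]). *)

Set Implicit Arguments.
Unset Strict Implicit.
Unset Printing Implicit Defensive.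

Import Order.TTheory GRing.Theory Num.Theory.
Import numFieldNormedType.Exports.

Local Open Scope classical_set_scope.
Local Open Scope ring_scope.
Local Open Scope complex_scope.
Local Open Scope sesquilinear_scope.

(** * Complex scalars and quadratic forms *)

Section RealPart.
Context {R : realType}.
Local Notation C := R[i].
Implicit Types z : C.

Lemma ReD z1 z2 : complex.Re (z1 + z2) = complex.Re z1 + complex.Re z2.
Proof. by case: z1 z2 => [a b] [c d]. Qed.

Lemma ReN z : complex.Re (- z) = - complex.Re z.
Proof. by case: z. Qed.

Lemma Re_sum (I : Type) (r : seq I) (P : pred I) (F : I -> C) :
  complex.Re (\sum_(k <- r | P k) F k) = \sum_(k <- r | P k) complex.Re (F k).
Proof. by apply: (big_morph _ ReD). Qed.

Lemma ReZ (a : R) z : complex.Re (a%:C * z) = a * complex.Re z.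
Proof. by case: z => b c /=; rewrite mul0r subr0. Qed.

Lemma conjC_real (a : R) : Num.conj (a%:C) = a%:C :> C.
Proof. by apply/conj_Creal/complex_realP; exists a. Qed.

Definition sqm z : R := complex.Re (Num.conj z * z).

Lemma sqmE z : sqm z = complex.Re z ^+ 2 + complex.Im z ^+ 2.
Proof. by case: z => a b; rewrite /sqm /=; ring. Qed.

Lemma sqm_ge0 z : 0 <= sqm z.
Proof. by rewrite sqmE addr_ge0 ?sqr_ge0. Qed.

Lemma sqm_Re z : complex.Re z ^+ 2 <= sqm z.
Proof. by rewrite sqmE lerDl sqr_ge0. Qed.

Lemma sqmC z : (sqm z)%:C = Num.conj z * z.
Proof.
by case: z => a b; rewrite /sqm /=  /=; simpc; congr (_ +i* _); ring.
Qed.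

Lemma sqm_eq0 z : sqm z = 0 -> z = 0.
Proof.
rewrite sqmE => /eqP; rewrite paddr_eq0 ?sqr_ge0 // !sqrf_eq0.
by case: z => a b /= /andP[/eqP-> /eqP->].
Qed.

End RealPart.

Section Basics.
Context {R : realType}.
Local Notation C := R[i].

Lemma adjM m n q (A : 'M[C]_(m, n)) (B : 'M[C]_(n, q)) :
  (A *m B)^t* = B^t* *m A^t*.
Proof. by rewrite trmx_mul map_mxM. Qed.

Lemma adjD m n (A B : 'M[C]_(m, n)) : (A + B)^t* = A^t* + B^t*.
Proof. by rewrite linearD /= map_mxD. Qed.

Lemma adjN m n (A : 'M[C]_(m, n)) : (- A)^t* = - A^t*.
Proof. by rewrite linearN /= map_mxN. Qed.

Lemma adj_sum m n (I : Type) (r : seq I) (P : pred I) (F : I -> 'M[C]_(m, n)) :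
  (\sum_(k <- r | P k) F k)^t* = \sum_(k <- r | P k) (F k)^t*.
Proof.
elim/big_rec2: _ => [|k y x _ <-]; last by rewrite adjD.
by rewrite trmx0 map_mx0.
Qed.

Lemma adjZ m n (a : R) (A : 'M[C]_(m, n)) : (a%:C *: A)^t* = a%:C *: A^t*.
Proof. by apply/matrixP => i j; rewrite !mxE rmorphM /= conjC_real. Qed.

Lemma adj1 n : (1%:M : 'M[C]_n)^t* = 1%:M.
Proof. by rewrite trmx1 map_mx1. Qed.

Lemma adj0 m n : (0 : 'M[C]_(m, n))^t* = 0.
Proof. by rewrite trmx0 map_mx0. Qed.

Lemma unitaryMadj n (U : 'M[C]_n) : U \is unitarymx -> U *m U^t* = 1%:M.
Proof. by move=> /unitarymxP. Qed.

Lemma unitaryadjM n (U : 'M[C]_n) : U \is unitarymx -> U^t* *m U = 1%:M.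
Proof.
by move=> uU; rewrite -(invmx_unitary uU) mulVmx // unitarymx_unit.
Qed.

(** Taking the real part makes this an R-valued function, additive in M; nothing
    is lost when M is hermitian. *)
Definition qf n (M : 'M[C]_n) (v : 'cV[C]_n) : R :=
  complex.Re ((v^t* *m M *m v) 0 0).

Lemma qfD n (M N : 'M[C]_n) v : qf (M + N) v = qf M v + qf N v.
Proof. by rewrite /qf mulmxDr mulmxDl mxE ReD. Qed.

Lemma qfN n (M : 'M[C]_n) v : qf (- M) v = - qf M v.
Proof. by rewrite /qf mulmxN mulNmx mxE ReN. Qed.

Lemma qfB n (M N : 'M[C]_n) v : qf (M - N) v = qf M v - qf N v.
Proof. by rewrite qfD qfN. Qed.

Lemma qf0 n (v : 'cV[C]_n) : qf 0 v = 0.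
Proof. by rewrite /qf mulmx0 mul0mx mxE. Qed.

Lemma qf_sum n (I : Type) (r : seq I) (P : pred I) (F : I -> 'M[C]_n) v :
  qf (\sum_(k <- r | P k) F k) v = \sum_(k <- r | P k) qf (F k) v.
Proof. by apply: (big_morph (fun M => qf M v)) => [M N|]; rewrite ?qfD ?qf0. Qed.

Lemma qfZ n (a : R) (M : 'M[C]_n) v : qf (a%:C *: M) v = a * qf M v.
Proof. by rewrite /qf -scalemxAr -scalemxAl mxE ReZ. Qed.

Lemma qf_conj n m (M : 'M[C]_n) (B : 'M[C]_(n, m)) v :
  qf (B^t* *m M *m B) v = qf M (B *m v).
Proof. by rewrite /qf adjM !mulmxA. Qed.

Lemma qf_gram n m (B : 'M[C]_(n, m)) v : qf (B^t* *m B) v = qf 1%:M (B *m v).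
Proof. by rewrite -qf_conj mulmx1. Qed.

Lemma qf1E n (v : 'cV[C]_n) : qf 1%:M v = \sum_k sqm (v k 0).
Proof.
rewrite /qf mulmx1 mxE Re_sum; apply: eq_bigr => k _.
by rewrite /sqm !mxE.
Qed.

Lemma qf1_ge0 n (v : 'cV[C]_n) : 0 <= qf 1%:M v.
Proof. by rewrite qf1E sumr_ge0 // => k _; exact: sqm_ge0. Qed.

Lemma qf_gram_ge0 n m (B : 'M[C]_(n, m)) v : 0 <= qf (B^t* *m B) v.
Proof. by rewrite qf_gram qf1_ge0. Qed.

Lemma qf1_eq0 n (v : 'cV[C]_n) : qf 1%:M v = 0 -> v = 0.
Proof.
rewrite qf1E => /eqP; rewrite psumr_eq0 => [|k _]; last exact: sqm_ge0.
move=> /allP v0; apply/matrixP => k l; rewrite (ord1 l) mxE.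
by apply: sqm_eq0; apply/eqP/v0; rewrite mem_index_enum.
Qed.

Lemma qf_unitary n (U : 'M[C]_n) v : U \is unitarymx ->
  qf 1%:M (U *m v) = qf 1%:M v.
Proof. by move=> uU; rewrite -qf_gram unitaryadjM. Qed.

(** * Spectral forms and functional calculus *)

Definition diagR n (d : 'I_n -> R) : 'M[C]_n := diag_mx (\row_k (d k)%:C).

Lemma diagRE n (d : 'I_n -> R) i j : diagR d i j = (d j)%:C *+ (i == j).
Proof. by rewrite !mxE; case: eqVneq => [->|]. Qed.

Lemma eq_diagR n (d e : 'I_n -> R) : d =1 e -> diagR d = diagR e.
Proof. by move=> de; apply/matrixP => i j; rewrite !diagRE de. Qed.

Lemma diagRD n (d e : 'I_n -> R) :
  diagR d + diagR e = diagR (fun k => d k + e k).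
Proof.
by apply/matrixP => i j; rewrite mxE !diagRE -mulrnDl -rmorphD.
Qed.

Lemma diagRZ n (a : R) (d : 'I_n -> R) :
  a%:C *: diagR d = diagR (fun k => a * d k).
Proof.
by apply/matrixP => i j; rewrite mxE !diagRE mulrnAr -rmorphM.
Qed.

Lemma diagRM n (d e : 'I_n -> R) :
  diagR d *m diagR e = diagR (fun k => d k * e k).
Proof.
apply/matrixP => i j; rewrite mul_diag_mx !mxE.
by case: eqVneq => [->|]; rewrite ?mulr1n ?mulr0n ?mulr0 // -rmorphM.
Qed.

Lemma diagR_adj n (d : 'I_n -> R) : (diagR d)^t* = diagR d.
Proof.
apply/matrixP => i j; rewrite 2!mxE !diagRE rmorphMn /= conjC_real eq_sym.
by case: eqVneq => [->|].
Qed.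

(** A hermitian matrix in diagonalised form.  The unitary U is kept explicit, so
    that several functions of one matrix can be computed in a common eigenbasis,
    independently of the eigenbasis that [spectralmx] selects. *)
Definition spec n (U : 'M[C]_n) (d : 'I_n -> R) : 'M[C]_n :=
  U^t* *m diagR d *m U.

Lemma eq_spec n (U : 'M[C]_n) (d e : 'I_n -> R) : d =1 e -> spec U d = spec U e.
Proof. by move=> de; rewrite /spec (eq_diagR de). Qed.

Lemma specD n (U : 'M[C]_n) d e :
  spec U d + spec U e = spec U (fun k => d k + e k).
Proof. by rewrite /spec -mulmxDl -mulmxDr diagRD. Qed.

Lemma specZ n (U : 'M[C]_n) (a : R) d :
  a%:C *: spec U d = spec U (fun k => a * d k).
Proof. by rewrite /spec scalemxAl scalemxAr diagRZ. Qed.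

Lemma spec_adj n (U : 'M[C]_n) d : (spec U d)^t* = spec U d.
Proof. by rewrite /spec !adjM trmxCK mulmxA diagR_adj. Qed.

Lemma specM n (U : 'M[C]_n) d e : U \is unitarymx ->
  spec U d *m spec U e = spec U (fun k => d k * e k).
Proof.
by move=> uU; rewrite /spec -diagRM !mulmxA mulmxtVK.
Qed.

Lemma spec1 n (U : 'M[C]_n) : U \is unitarymx -> spec U (fun=> 1) = 1%:M.
Proof.
move=> uU; rewrite /spec (_ : diagR _ = 1%:M); first by rewrite mulmx1 unitaryadjM.
by apply/matrixP => i j; rewrite !mxE.
Qed.

Lemma spec0 n (U : 'M[C]_n) : spec U (fun=> 0) = 0.
Proof.
rewrite /spec (_ : diagR _ = 0) ?mulmx0 ?mul0mx //.
by apply/matrixP => i j; rewrite !mxE mul0rn.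
Qed.

Lemma tr_spec n (U : 'M[C]_n) d : U \is unitarymx ->
  complex.Re (\tr (spec U d)) = \sum_k d k.
Proof.
move=> uU; rewrite /spec -mulmxA mxtrace_mulC mulmxtVK // /mxtrace Re_sum.
by apply: eq_bigr => k _; rewrite !mxE eqxx.
Qed.

Lemma qf_spec n (U : 'M[C]_n) d v :
  qf (spec U d) v = \sum_k d k * sqm ((U *m v) k 0).
Proof.
rewrite /spec qf_conj /qf -mulmxA mul_diag_mx mxE Re_sum.
by apply: eq_bigr => k _; rewrite !mxE mulrCA ReZ.
Qed.

(** The columns of U^* are the eigenvectors of [spec U d]; they form an
    orthonormal basis. *)
Definition evec n (U : 'M[C]_n) (k : 'I_n) : 'cV[C]_n := col k (U^t* ).

Lemma mul_evec n (U : 'M[C]_n) k : U \is unitarymx -> U *m evec U k = col k 1%:M.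
Proof. by move=> uU; rewrite /evec !colE mulmxA unitaryMadj. Qed.

Lemma spec_evec n (U : 'M[C]_n) d k : U \is unitarymx ->
  spec U d *m evec U k = (d k)%:C *: evec U k.
Proof.
move=> uU; rewrite /spec -!mulmxA mul_evec //.
have -> : diagR d *m col k 1%:M = (d k)%:C *: (U *m evec U k).
  rewrite mul_evec //; apply/matrixP => i j; rewrite mul_diag_mx !mxE.
  by case: eqVneq => [->|_]; rewrite ?mulr0.
by rewrite -scalemxAr mulmxA unitaryadjM // mul1mx.
Qed.

Lemma qf1_evec n (U : 'M[C]_n) k : U \is unitarymx -> qf 1%:M (evec U k) = 1.
Proof.
move=> uU; rewrite -(qf_unitary _ uU) mul_evec // qf1E (bigD1 k) //= big1 ?addr0.
  by rewrite !mxE eqxx sqmE /= expr1n expr0n addr0.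
by move=> j jk; rewrite !mxE (negPf jk) sqmE /= expr0n addr0.
Qed.

Lemma qf_evec n (U : 'M[C]_n) d k : U \is unitarymx ->
  qf (spec U d) (evec U k) = d k.
Proof.
move=> uU; rewrite qf_spec mul_evec // (bigD1 k) //= big1 ?addr0.
  by rewrite !mxE eqxx sqmE /= expr1n expr0n addr0 mulr1.
by move=> j jk; rewrite !mxE (negPf jk) sqmE /= expr0n addr0 mulr0.
Qed.

Lemma tr_evec n (U : 'M[C]_n) (N : 'M[C]_n) : U \is unitarymx ->
  complex.Re (\tr N) = \sum_k qf N (evec U k).
Proof.
move=> uU; have -> : N = N *m U^t* *m U by rewrite -mulmxA unitaryadjM ?mulmx1.
rewrite mxtrace_mulC /mxtrace Re_sum; apply: eq_bigr => k _.
rewrite -[N *m U^t* *m U]mulmxA unitaryadjM // mulmx1 /qf /evec mulmxA.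
have -> : (col k (U^t* ))^t* = row k U.
  by apply/matrixP => i j; rewrite !mxE conjCK.
rewrite -row_mul mxE [in RHS]mxE; congr complex.Re.
by apply: eq_bigr => j _; rewrite !mxE.
Qed.

(** If V diagonalises the same matrix with eigenvalues s, then W = V U^* satisfies
    diag(s) W = W diag(d), so W i j = 0 unless s i = d j; hence W also
    intertwines diag(f(s)) and diag(f(d)). *)
Lemma funcalc_spec n (U : 'M[C]_n) d (f : R -> R) : U \is unitarymx ->
  funcalc f (spec U d) = spec U (f \o d).
Proof.
move=> uU; set P := spec U d.
have Pherm : P \is hermsymmx by apply/is_hermitianmxP; rewrite expr0 scale1r spec_adj.
have uV := spectral_unitarymx P.
have := orthomx_spectralP (hermitian_normalmx Pherm).
have := hermitian_spectral_diag_real Pherm.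
rewrite /funcalc (invmx_unitary uV).
move: (spectralmx P) (spectral_diag P) uV => V s uV rs PE.
set W := V *m U^t*.
have W1 : diag_mx s *m W = W *m diagR d.
  have E1 : V *m P *m U^t* = diag_mx s *m W.
    by rewrite PE !mulmxA (unitaryMadj uV) mul1mx.
  by rewrite -E1 /P /spec !mulmxA (mulmxtVK _ uU).
have W2 : diag_mx (map_mx (fun z => (f (complex.Re z))%:C) s) *m W =
          W *m diagR (f \o d).
  clearbody W.
  apply/matrixP => i j; have /matrixP/(_ i j) := W1.
  rewrite !mul_diag_mx !mul_mx_diag !mxE.
  have [->|W0] := eqVneq (W i j) 0; first by rewrite !(mul0r, mulr0).
  by rewrite mulrC => /(mulfI W0) -> /=; rewrite mulrC.
have -> : U = W^t* *m V.
  by rewrite /W adjM trmxCK -mulmxA (unitaryadjM uV) mulmx1.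
have WW : W *m W^t* = 1%:M.
  by rewrite /W adjM trmxCK !mulmxA (mulmxKtV _ uU) // (unitaryMadj uV).
clearbody W; rewrite /spec adjM trmxCK -!mulmxA [W *m _]mulmxA -W2.
by rewrite -(mulmxA _ W) [W *m (_ *m _)]mulmxA WW mul1mx.
Qed.

Lemma herm_spec n (P : 'M[C]_n) : P^t* = P ->
  exists U d, U \is unitarymx /\ P = spec U d.
Proof.
move=> Ph.
have Pherm : P \is hermsymmx by apply/is_hermitianmxP; rewrite expr0 scale1r Ph.
exists (spectralmx P), (fun k => complex.Re (spectral_diag P 0 k)).
split; first exact: spectral_unitarymx.
rewrite {1}(orthomx_spectralP (hermitian_normalmx Pherm)).
rewrite (invmx_unitary (spectral_unitarymx P)) /spec /diagR.
rewrite (_ : \row_k _ = spectral_diag P) //.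
apply/rowP => k; rewrite mxE RRe_real //.
by have /mxOverP := hermitian_spectral_diag_real Pherm; apply.
Qed.

Lemma psd_spec n (P : 'M[C]_n) : P^t* = P -> (forall v, 0 <= qf P v) ->
  exists U d, [/\ U \is unitarymx, P = spec U d & forall k, 0 <= d k].
Proof.
move=> /herm_spec[U [d [uU ->]]] P0; exists U, d; split=> // k.
by rewrite -(qf_evec d k uU).
Qed.

Lemma mxabs_spec n (A : 'M[C]_n) : exists U d, [/\ U \is unitarymx,
  mxabs A = spec U d, A^t* *m A = spec U (fun k => d k ^+ 2) &
  forall k, 0 <= d k].
Proof.
have [|v|U [d [uU AE d0]]] := @psd_spec n (A^t* *m A).
- by rewrite adjM trmxCK.
- exact: qf_gram_ge0.
exists U, (fun k => Num.sqrt (d k)); split.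
- exact: uU.
- by rewrite /mxabs AE; exact: funcalc_spec.
- by rewrite AE; apply: eq_spec => k; rewrite sqr_sqrtr ?d0.
- by move=> k; rewrite sqrtr_ge0.
Qed.

Lemma mxabs_psd n (U : 'M[C]_n) d : U \is unitarymx -> (forall k, 0 <= d k) ->
  mxabs (spec U d) = spec U d.
Proof.
move=> uU d0; rewrite /mxabs spec_adj (specM _ _ uU) (funcalc_spec _ _ uU).
by apply: eq_spec => k /=; rewrite -expr2 sqrtr_sqr ger0_norm.
Qed.

(** Tr |A|^p, the p-th power of the Schatten norm; unlike the norm it is additive
    over eigenvalues. *)
Definition trp n (p : R) (A : 'M[C]_n) : R :=
  complex.Re (\tr (funcalc (fun x => x `^ p) (mxabs A))).

Lemma trp_abs n (p : R) (A U : 'M[C]_n) d : U \is unitarymx ->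
  mxabs A = spec U d -> trp p A = \sum_k d k `^ p.
Proof. by move=> uU AE; rewrite /trp AE funcalc_spec // tr_spec. Qed.

Lemma trp_spec n (p : R) (U : 'M[C]_n) d : U \is unitarymx ->
  (forall k, 0 <= d k) -> trp p (spec U d) = \sum_k d k `^ p.
Proof. by move=> uU d0; rewrite (trp_abs p uU (mxabs_psd uU d0)). Qed.

Lemma trp_ge0 n (p : R) (A : 'M[C]_n) : 0 <= trp p A.
Proof.
have [U [d [uU AE _ _]]] := mxabs_spec A.
by rewrite (trp_abs p uU AE) sumr_ge0 // => k _; rewrite powR_ge0.
Qed.

End Basics.

(** * Contractions, Jensen's inequality and monotonicity *)

Section Inequalities.
Context {R : realType}.
Local Notation C := R[i].

Lemma dotxx n (x : 'cV[C]_n) : (x^t* *m x) 0 0 = (qf 1%:M x)%:C.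
Proof.
rewrite qf1E mxE rmorph_sum; apply: eq_bigr => k _.
by rewrite /= sqmC !mxE.
Qed.

Lemma adjZc m n (z : C) (A : 'M[C]_(m, n)) : (z *: A)^t* = Num.conj z *: A^t*.
Proof. by apply/matrixP => i j; rewrite !mxE rmorphM. Qed.

(** Nonnegativity of the norm of a y - z x, where a = x^* x and z = x^* y. *)
Lemma cauchy_schwarz n (x y : 'cV[C]_n) :
  sqm ((x^t* *m y) 0 0) <= qf 1%:M x * qf 1%:M y.
Proof.
set z := (x^t* *m y) 0 0; set a := qf 1%:M x; set b := qf 1%:M y.
have zE : (y^t* *m x) 0 0 = Num.conj z.
  rewrite /z !mxE rmorph_sum; apply: eq_bigr => k _.
  by rewrite rmorphM /= !mxE conjCK mulrC.
have := qf1_ge0 (a%:C *: y - z *: x).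
have : ((a%:C *: y - z *: x)^t* *m (a%:C *: y - z *: x)) 0 0
    = (a * (a * b - sqm z))%:C.
  have xx : (x^t* *m x) 0 0 = a%:C by exact: dotxx.
  have yy : (y^t* *m y) 0 0 = b%:C by exact: dotxx.
  rewrite adjD adjN !adjZc /= conjC_real.
  rewrite mulmxDl mulmxDr mulmxDr !mulNmx !mulmxN !opprK.
  rewrite -!scalemxAl -!scalemxAr !mxE.
  move: xx yy zE; rewrite !mxE => -> -> ->.
  have -> : \sum_j (x^t* ) 0 j * y j 0 = z by rewrite /z mxE.
  rewrite !(rmorphM, rmorphB) /= sqmC; ring.
rewrite dotxx => /complexI -> ; have a0 : 0 <= a by exact: qf1_ge0.
have [a00|an0] := eqVneq a 0.
  have x0 : x = 0 by exact: qf1_eq0.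
  by rewrite a00 !mul0r /z x0 adj0 mul0mx mxE sqmE /= expr0n addr0 lexx.
by rewrite pmulr_rge0 ?subr_ge0 // lt_def an0.
Qed.

(** ||B^* v||^2 = v^* B (B^* v) <= ||v|| ||B B^* v|| <= ||v|| ||B^* v||. *)
Lemma contraction_adj n (B : 'M[C]_n) :
  (forall v, qf 1%:M (B *m v) <= qf 1%:M v) ->
  forall v, qf 1%:M (B^t* *m v) <= qf 1%:M v.
Proof.
move=> cB v; set N := qf 1%:M (B^t* *m v).
have N0 : 0 <= N by exact: qf1_ge0.
have NE : complex.Re ((v^t* *m (B *m (B^t* *m v))) 0 0) = N.
  by rewrite /N -qf_gram trmxCK /qf !mulmxA.
have := cauchy_schwarz v (B *m (B^t* *m v)) => cs.
have {cs} := le_trans (sqm_Re _) cs; rewrite NE => cs.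
have := le_trans cs (ler_wpM2l (qf1_ge0 v) (cB _)); rewrite -/N expr2.
have [->|Nn0] := eqVneq N 0; first by rewrite qf1_ge0.
by rewrite ler_pM2r // lt_def Nn0.
Qed.

Lemma mx_ext m n (A B : 'M[C]_(m, n)) : (forall v : 'cV_n, A *m v = B *m v) -> A = B.
Proof.
move=> AB; apply/matrixP => i j; have := AB (delta_mx j 0).
by rewrite -!colE => /matrixP/(_ i 0); rewrite !mxE.
Qed.

Lemma gram_eq0 m n (X : 'M[C]_(m, n)) : X^t* *m X = 0 -> X = 0.
Proof.
move=> X0; apply: mx_ext => v; rewrite mul0mx; apply: qf1_eq0.
by rewrite -qf_gram X0 qf0.
Qed.

(** The partial isometry V = B |B|^+; the convention 0^-1 = 0 makes the entrywise
    inverse of the spectrum a pseudo-inverse. *)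
Lemma polar n (B : 'M[C]_n) : exists V : 'M[C]_n,
  [/\ B = V *m mxabs B, V^t* *m B = mxabs B,
      forall v, qf 1%:M (V *m v) <= qf 1%:M v &
      forall v, qf 1%:M (V^t* *m v) <= qf 1%:M v].
Proof.
have [U [d [uU aB BB d0]]] := mxabs_spec B.
set V := B *m spec U (fun k => (d k)^-1).
have cV v : qf 1%:M (V *m v) <= qf 1%:M v.
  rewrite -qf_gram /V adjM spec_adj mulmxA -(mulmxA _ _ B) BB !(specM _ _ uU).
  rewrite qf_spec -(qf_unitary v uU) qf1E ler_sum // => k _.
  rewrite ler_piMl ?sqm_ge0 //.
  have [->|dn0] := eqVneq (d k) 0; first by rewrite invr0 mulr0.
  by rewrite expr2 mulrA mulVf // mul1r divff.
exists V; split; [| | exact: cV | exact: contraction_adj cV].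
- apply/eqP; rewrite -subr_eq0 aB /V -mulmxA (specM _ _ uU).
  rewrite -{1}[B]mulmx1 -(spec1 uU) -mulmxBr.
  rewrite -[- spec U _]scaleN1r.
  have -> : -1 = (-1)%:C :> C by rewrite rmorphN rmorph1.
  rewrite specZ specD; apply/eqP/gram_eq0.
  rewrite adjM spec_adj mulmxA -(mulmxA _ _ B) BB !(specM _ _ uU).
  rewrite -[RHS](spec0 U); apply: eq_spec => k /=.
  have [->|dn0] := eqVneq (d k) 0; first by rewrite expr0n /= !(mulr0, mul0r).
  by rewrite mulVf // mulr1 subrr !mulr0.
- rewrite /V adjM spec_adj -mulmxA BB (specM _ _ uU) aB.
  apply: eq_spec => k; have [->|dn0] := eqVneq (d k) 0.
    by rewrite expr0n mulr0.
  by rewrite expr2 mulrA mulVf ?mul1r.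
Qed.

(** The graph of x^p lies above its tangent at m (Young's inequality for x and
    m^(p-1)). *)
Lemma powR_tangent (p x m : R) : 1 <= p -> 0 <= x -> 0 <= m ->
  p * (m `^ (p - 1) * x) <= x `^ p + (p - 1) * m `^ p.
Proof.
move=> p1 x0 m0; have [->|pn1] := eqVneq p 1.
  by rewrite subrr powRr0 !mul1r mul0r addr0 powRr1.
have {p1 pn1} p1 : 1 < p by rewrite lt_def pn1.
have p0 : 0 < p by lra.
have pB : 0 < p - 1 by lra.
have q0 : 0 < p / (p - 1) by rewrite divr_gt0.
have /= := conjugate_powR x0 (powR_ge0 m (p - 1)) p0 q0.
rewrite -powRrM mulrCA divff ?gt_eqF // mulr1 => H.
have {}H : x * m `^ (p - 1) <= x `^ p / p + m `^ p / (p / (p - 1)).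
  by apply: H; field; rewrite !gt_eqF.
have := ler_wpM2l (ltW p0) H.
have -> : p * (x `^ p / p + m `^ p / (p / (p - 1))) = x `^ p + (p - 1) * m `^ p.
  by field; rewrite !gt_eqF.
by rewrite (mulrC x).
Qed.

Lemma powR_convex2 (p k a b : R) : 1 <= p -> 0 <= k <= 1 -> 0 <= a -> 0 <= b ->
  (k * a + (1 - k) * b) `^ p <= k * a `^ p + (1 - k) * b `^ p.
Proof.
move=> p1 /andP[k0 k1] a0 b0; have := convex_powR p1 (Itv01 k0 k1) (x := a) (y := b).
rewrite !inE /= !in_itv /= !andbT => /(_ a0 b0).
by rewrite !convRE.
Qed.

Lemma powR_half (p a b : R) : 1 <= p -> 0 <= a -> 0 <= b ->
  2 * ((a + b) / 2) `^ p <= a `^ p + b `^ p.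
Proof.
move=> p1 a0 b0; have h01 : 0 <= (1 / 2 : R) <= 1 by lra.
have := powR_convex2 p1 h01 a0 b0.
have -> : 1 / 2 * a + (1 - 1 / 2) * b = (a + b) / 2 by field.
lra.
Qed.

(** The weights of v in the eigenbasis may sum to less than 1; this is harmless
    because x^p vanishes at 0.  The proof sums the tangent inequality at the
    mean. *)
Lemma jensen_qf n (U : 'M[C]_n) (d : 'I_n -> R) p v : U \is unitarymx ->
  (forall k, 0 <= d k) -> 1 <= p -> qf 1%:M v <= 1 ->
  (qf (spec U d) v) `^ p <= qf (spec U (fun k => d k `^ p)) v.
Proof.
move=> uU d0 p1; rewrite -(qf_unitary v uU) qf1E => w1.
rewrite !qf_spec; set m := (X in X `^ p).
have m0 : 0 <= m by rewrite sumr_ge0 // => k _; rewrite mulr_ge0 ?sqm_ge0.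
have mE : m `^ (p - 1) * m = m `^ p.
  by rewrite mulrC mulr_powRB1 //; lra.
pose w k := sqm ((U *m v) k 0).
have : \sum_k (p * (m `^ (p - 1) * d k)) * w k <=
       \sum_k (d k `^ p + (p - 1) * m `^ p) * w k.
  apply: ler_sum => k _; rewrite ler_wpM2r ?sqm_ge0 //.
  exact: powR_tangent.
under eq_bigr do rewrite -!mulrA.
rewrite -!mulr_sumr -/m mE.
under [X in _ <= X -> _]eq_bigr do rewrite mulrDl.
rewrite big_split /= -mulr_sumr -lerBlDr; apply: le_trans.
have mp : 0 <= (p - 1) * m `^ p by rewrite mulr_ge0 ?powR_ge0 //; lra.
have := ler_wpM2l mp w1; rewrite mulr1 /w; lra.
Qed.

(** Polar decomposition and Cauchy-Schwarz give
    |e^* B e|^2 <= <|B| V^* e, V^* e> <|B| e, e>.  Jensen's inequality then applies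
    to both factors, and both resulting sums are at most Tr |B|^p. *)
Lemma diag_le_trp n (B W : 'M[C]_n) p : W \is unitarymx -> 1 <= p ->
  \sum_k `|qf B (evec W k)| `^ p <= trp p B.
Proof.
move=> uW p1; have [V [BV _ cV cVa]] := polar B.
have [U [d [uU aB _ d0]]] := mxabs_spec B.
pose N := spec U d; pose Np := spec U (fun k => d k `^ p).
pose h := spec U (fun k => Num.sqrt (d k)).
have hh : h *m h = N.
  by rewrite /h (specM _ _ uU); apply: eq_spec => k; rewrite -expr2 sqr_sqrtr.
have h_adj : h^t* = h by exact: spec_adj.
clearbody h.
have qN v : qf N v = qf 1%:M (h *m v) by rewrite -hh -{1}h_adj qf_gram.
have key e : `|qf B e| <= (qf N (V^t* *m e) + qf N e) / 2.
  have : qf B e ^+ 2 <= qf N (V^t* *m e) * qf N e.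
    rewrite !qN; apply: le_trans (cauchy_schwarz _ _); apply: le_trans (sqm_Re _).
    rewrite le_eqVlt; apply/orP; left; apply/eqP; congr (_ ^+ 2).
    by rewrite /qf BV aB -/N -hh !adjM trmxCK h_adj !mulmxA.
  have := qf1_ge0 (h *m e); have := qf1_ge0 (h *m (V^t* *m e)).
  rewrite -!qN => a0 b0 H.
  have s0 : 0 <= (qf N (V^t* *m e) + qf N e) / 2 by rewrite divr_ge0 ?addr_ge0.
  rewrite -(@ler_pXn2r _ 2) ?nnegrE ?normr_ge0 //.
  rewrite real_normK ?num_real //; apply: le_trans H _.
  have := sqr_ge0 (qf N (V^t* *m e) - qf N e); nra.
have N0 v : 0 <= qf N v by rewrite qN qf1_ge0.
have trN : trp p B = \sum_k qf Np (evec W k).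
  by rewrite (trp_abs p uU aB) -tr_evec // tr_spec.
have trV : \sum_k qf Np (V^t* *m evec W k) <= trp p B.
  pose hp := spec U (fun k => Num.sqrt (d k `^ p)).
  have hpE : hp^t* *m hp = Np.
    rewrite spec_adj (specM _ _ uU); apply: eq_spec => k.
    by rewrite -expr2 sqr_sqrtr ?powR_ge0.
  have -> : \sum_k qf Np (V^t* *m evec W k) = \sum_k qf 1%:M (V *m (hp *m evec W k)).
    transitivity (complex.Re (\tr (V *m Np *m V^t* ))).
      rewrite (tr_evec _ uW); apply: eq_bigr => k _.
      by rewrite -qf_conj trmxCK.
    have hp_adj : hp^t* = hp by exact: spec_adj.
    rewrite mxtrace_mulC mulmxA -hpE hp_adj; clearbody hp.
    rewrite mulmxA mxtrace_mulC !mulmxA (tr_evec _ uW); apply: eq_bigr => k _.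
    by rewrite mulmxA -qf_gram adjM hp_adj !mulmxA.
  by rewrite trN; apply: ler_sum => k _; rewrite -hpE qf_gram; exact: cV.
have : \sum_k 2 * `|qf B (evec W k)| `^ p <=
       \sum_k (qf Np (V^t* *m evec W k) + qf Np (evec W k)).
  apply: ler_sum => k _.
  apply: (@le_trans _ _ (2 * ((qf N (V^t* *m evec W k) + qf N (evec W k)) / 2) `^ p)).
    rewrite ler_pM2l //; apply: ge0_ler_powR; rewrite ?nnegrE ?normr_ge0 //.
    - by lra.
    - by rewrite divr_ge0 // addr_ge0.
  apply: le_trans (powR_half p1 (N0 _) (N0 _)) _.
  have q1 := qf1_evec k uW.
  apply: lerD; apply: jensen_qf => //; last by rewrite q1.
  by rewrite -q1 cVa.
rewrite -mulr_sumr big_split /= -trN; lra.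
Qed.

(** Test N on the eigenbasis of M. *)
Lemma trp_mono n (M N : 'M[C]_n) p : 1 <= p -> M^t* = M ->
  (forall v, 0 <= qf M v) -> (forall v, qf M v <= qf N v) -> trp p M <= trp p N.
Proof.
move=> p1 Mh M0 MN; have [U [d [uU ME d0]]] := psd_spec Mh M0.
apply: le_trans (diag_le_trp N uU p1); rewrite ME trp_spec //.
apply: ler_sum => k _; apply: ge0_ler_powR; rewrite ?nnegrE ?normr_ge0 //; first lra.
by apply: le_trans (ler_norm _); apply: le_trans (MN _); rewrite ME qf_evec.
Qed.

(** Operator monotonicity of the square root, for |B|^2 <= F^2.  If F - |B| had an
    eigenvector u with eigenvalue e < 0, then |B| u = F u - e u would give
    || |B| u ||^2 = ||F u||^2 - 2 e u^* F u + e^2 > ||F u||^2. *)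
Lemma abs_mono n (B F : 'M[C]_n) : F^t* = F -> (forall v, 0 <= qf F v) ->
  (forall v, qf 1%:M (B *m v) <= qf 1%:M (F *m v)) ->
  forall v, qf (mxabs B) v <= qf F v.
Proof.
move=> Fh F0 BF v; have [U [d [uU aB BB d0]]] := mxabs_spec B.
set T := mxabs B in aB *.
have Th : T^t* = T by rewrite aB; exact: spec_adj.
have qT w : qf 1%:M (T *m w) = qf 1%:M (B *m w).
  rewrite -!qf_gram BB Th aB (specM _ _ uU).
  have -> : (fun k => d k ^+ 2) = (fun k => d k * d k) by apply/funext => k.
  by [].
have [|W [e [uW FT]]] := @herm_spec _ _ (F - T); first by rewrite adjD adjN Fh Th.
rewrite -subr_ge0 -qfB FT qf_spec sumr_ge0 // => k _.
rewrite mulr_ge0 ?sqm_ge0 // leNgt; apply/negP => ek.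
set u := evec W k; have u1 : qf 1%:M u = 1 by exact: qf1_evec.
have Tu : T *m u = (F - (e k)%:C *: 1%:M) *m u.
  rewrite mulmxBl -scalemxAl mul1mx -spec_evec // -FT mulmxBl.
  by rewrite opprB addrC subrK.
have := BF u; rewrite -qT Tu -!qf_gram adjD adjN adjZ adj1 Fh.
rewrite mulmxBl !mulmxBr -!scalemxAl -!scalemxAr mul1mx mulmx1 mul1mx.
rewrite !qfB !qfZ u1.
have h1 : e k * qf F u <= 0 by rewrite mulr_le0_ge0 // ltW.
have h2 : 0 < e k * e k by rewrite nmulr_lgt0.
by rewrite mulr1; move: (qf (F *m F) u) (qf F u) h1 => x y h1; lra.
Qed.

End Inequalities.

(** * Counting eigenvalues *)

Section Counting.
Context {R : realType}.

Lemma seq_max (x0 : R) (s : seq R) :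
  exists2 M, M \in x0 :: s & forall x : R, x \in x0 :: s -> x <= M.
Proof.
elim: s x0 => [|y s IH] x0.
  by exists x0; rewrite ?inE // => x; rewrite inE => /eqP->.
have [M Ms Mmax] := IH y; have [x0M|Mx0] := leP x0 M.
  exists M; first by rewrite inE Ms orbT.
  by move=> x; rewrite inE => /predU1P[->|/Mmax].
exists x0; first by rewrite inE eqxx.
move=> x; rewrite inE => /predU1P[->//|/Mmax xM].
by rewrite (le_trans xM) // ltW.
Qed.

(** If a has at most q more entries than b above every level, then pairing the
    entries in decreasing order leaves at most q entries of a unmatched.  The
    induction removes the largest entry M of a, together with an entry of b above
    M if there is one, and at the expense of q otherwise. *)
Lemma count_le_sum (h : R -> R) (H : R) (a b : seq R) (q : nat) :
  h 0 = 0 -> (forall x : R, 0 <= x -> 0 <= h x <= H) ->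
  (forall x y : R, 0 <= x -> x <= y -> h x <= h y) ->
  all (>= 0) a -> all (>= 0) b ->
  (forall t : R, 0 <= t -> (count (> t)%R a <= q + count (> t)%R b)%N) ->
  \sum_(x <- a) h x <= H * q%:R + \sum_(y <- b) h y.
Proof.
move=> h0 hH hm.
have H0 : 0 <= H by have /andP[] := hH 0 (lexx 0); rewrite h0.
have sum_ge0 (c : seq R) : all (>= 0) c -> 0 <= \sum_(y <- c) h y.
  move=> /allP c0; rewrite big_seq sumr_ge0 // => y /c0 y0.
  by have /andP[] := hH y y0.
move sz : (size a) => N; elim: N a b q sz => [|N IH] a b q sz a0 b0 ab.
  by rewrite (size0nil sz) big_nil addr_ge0 ?mulr_ge0 ?sum_ge0.
have [M Ma aM] : exists2 M, M \in a & forall x : R, x \in a -> x <= M.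
  by case: (a) sz => [//|x0 l] _; exact: seq_max.
have M0 : 0 <= M by exact: (allP a0).
have pa := perm_to_rem Ma; set a' := rem M a in pa.
have sz' : size a' = N by rewrite size_rem // sz.
have a'0 : all (>= 0) a' by apply/allP => x /mem_rem; exact: (allP a0).
have a'M (x : R) : x \in a' -> x <= M by move/mem_rem; exact: aM.
have cnt0 (t : R) : M <= t -> count (> t)%R a' = 0%N.
  move=> Mt; apply/eqP; rewrite -leqn0 leqNgt -has_count; apply/hasPn => x xa'.
  by rewrite -leNgt (le_trans (a'M _ xa')).
have cnta (t : R) : t < M -> count (> t)%R a = (count (> t)%R a').+1.
  by move=> tM; rewrite (permP pa) /= tM.
rewrite (perm_big _ pa) big_cons /=.
have [/hasP[M' M'b MM']|/hasPn bM] := boolP (has (>= M) b).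
  have pb := perm_to_rem M'b; set b' := rem M' b in pb.
  have b'0 : all (>= 0) b' by apply/allP => x /mem_rem; exact: (allP b0).
  rewrite (perm_big _ pb) big_cons /= addrCA.
  apply: lerD; first exact: hm.
  apply: IH => // t t0; have [Mt|tM] := leP M t; first by rewrite cnt0.
  have := ab t t0; rewrite cnta // (permP pb) /= (lt_le_trans tM MM').
  by rewrite addnS ltnS.
have [t tb bt] := seq_max 0 b.
have t0 : 0 <= t by apply: bt; rewrite inE eqxx.
have [Mz|Mp] := leP M 0.
  have -> : M = 0 by apply/eqP; rewrite eq_le Mz.
  rewrite h0 add0r big_seq big1 ?addr_ge0 ?mulr_ge0 ?sum_ge0 // => x xa.
  suff -> : x = 0 by [].
  by apply/eqP; rewrite eq_le (le_trans (a'M x xa)) // (allP a'0).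
have tM : t < M.
  by move: tb; rewrite inE => /predU1P[->//|/bM]; rewrite -ltNge.
have q1 : (0 < q)%N.
  have := ab t t0; rewrite cnta //.
  suff -> : count (> t)%R b = 0%N by rewrite addn0; exact: leq_trans.
  apply/eqP; rewrite -leqn0 leqNgt -has_count; apply/hasPn => x xb.
  by rewrite -leNgt bt // inE xb orbT.
have -> : H * q%:R = H + H * q.-1%:R.
  by rewrite -{1}(prednK q1) -natr1 mulrDr mulr1 addrC.
rewrite -addrA; apply: lerD; first by have /andP[] := hH M M0.
apply: IH => // u u0; have [Mu|uM] := leP M u; first by rewrite cnt0.
by have := ab u u0; rewrite cnta // -{1}(prednK q1) addSn ltnS.
Qed.

End Counting.

Section Projections.
Context {R : realType}.
Local Notation C := R[i].

Lemma rank_diag_le n (P : pred 'I_n) :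
  (\rank (diagR (fun k => (P k)%:R) : 'M[C]_n) <= #|P|)%N.
Proof.
have -> : diagR (fun k => (P k)%:R) = \sum_(k in P) (delta_mx k k : 'M[C]_n).
  apply/matrixP => i j; rewrite diagRE summxE.
  have [Pj|nPj] := boolP (P j).
    rewrite (bigD1 j) //= big1 ?addr0 => [|k /andP[_ kj]].
      by rewrite [RHS]mxE eqxx andbT; case: (i == j).
    by rewrite mxE (eq_sym j) (negPf kj) andbF.
  rewrite big1 ?mul0rn // => k Pk; rewrite mxE.
  case: (eqVneq j k) => [jk|]; last by rewrite andbF.
  by exfalso; move: nPj Pk; rewrite jk unfold_in => /negPf ->.
rewrite -sum1_card; elim/big_ind2: _ => [|x1 x2 y1 y2 h1 h2|k _].
- by rewrite mxrank0.
- by apply: leq_trans (mxrank_add _ _) _; exact: leq_add.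
- by rewrite mxrank_delta.
Qed.

Lemma rank_spec n (U : 'M[C]_n) (P : pred 'I_n) : U \is unitarymx ->
  \rank (spec U (fun k => (P k)%:R)) = #|P|.
Proof.
move=> uU; rewrite /spec.
have uUa : U^t* \in unitmx.
  by apply: unitarymx_unit; rewrite trmxC_unitary.
rewrite mxrankMfree ?row_free_unit ?unitarymx_unit //.
rewrite (eqmxMfull _ (_ : row_full (U^t* ))) ?row_full_unit //.
apply/eqP; rewrite eqn_leq rank_diag_le /=.
rewrite -(leq_add2r #|predC P|) cardC card_ord.
apply: leq_trans (leq_add (leqnn _) (rank_diag_le (predC P))).
apply: leq_trans (mxrank_add _ _); rewrite diagRD.
rewrite (_ : diagR _ = 1%:M) ?mxrank1 //.
apply/matrixP => i j; rewrite diagRE mxE /=.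
by case: (P j); rewrite ?addr0 ?add0r.
Qed.

Lemma spec_ext n (E A : 'M[C]_n) d : E \is unitarymx ->
  (forall k, A *m evec E k = (d k)%:C *: evec E k) -> A = spec E d.
Proof.
move=> uE Ae; rewrite -[A]mulmx1 -[spec E d]mulmx1 -(unitaryadjM uE) !mulmxA.
congr (_ *m _); apply/matrixP => i k.
have := Ae k; rewrite -(spec_evec d k uE) /evec !colE !mulmxA -!colE.
by move/matrixP/(_ i 0); rewrite !mxE.
Qed.

(** If the count failed, some v <> 0 in the span of the eigenvectors of |S| above
    t would be killed by Q and by the eigenprojection of |S (1 - Q)| above t.
    Then ||S v|| = ||S (1 - Q) v|| <= t ||v||, while ||S v|| > t ||v||. *)
Lemma interlacing_count n (S Q U U' : 'M[C]_n) (s s' : 'I_n -> R) (t : R) :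
  U \is unitarymx -> U' \is unitarymx ->
  S^t* *m S = spec U (fun k => s k ^+ 2) ->
  (S *m (1%:M - Q))^t* *m (S *m (1%:M - Q)) = spec U' (fun k => s' k ^+ 2) ->
  (forall k, 0 <= s k) -> (forall k, 0 <= s' k) -> 0 <= t ->
  (#|[pred k | (t < s k)%R]| <= \rank Q + #|[pred k | (t < s' k)%R]|)%N.
Proof.
move=> uU uU' SS SS' s0 s'0 t0; rewrite leqNgt; apply/negP.
rewrite -(rank_spec [pred k | t < s k] uU) -(rank_spec [pred k | t < s' k] uU').
move ED : (spec U _) => E; move ED' : (spec U' _) => E' rk.
move ND : (col_mx Q E' *m E) => N.
have rN : (\rank N < \rank E)%N.
  rewrite -ND; apply: leq_ltn_trans rk; apply: leq_trans (mxrankM_maxl _ _) _.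
  by rewrite -addsmxE mxrank_adds_leqif.
have : E *m cokermx N != 0.
  by rewrite -submxE; apply/negP => /mxrankS; rewrite leqNgt rN.
move/eqP; apply; apply: mx_ext => w; rewrite mul0mx.
have [v vD] : exists v, v = (E *m cokermx N) *m w by eexists.
rewrite -vD.
have EE : E *m E = E.
  by rewrite -ED (specM _ _ uU); apply: eq_spec => k; case: ([pred _ | _] k); rewrite ?mulr1 ?mulr0.
have Eh : E^t* = E by rewrite -ED; exact: spec_adj.
have Ev : E *m v = v by rewrite vD 2!mulmxA EE.
have : col_mx Q E' *m v = 0.
  by rewrite vD 2!mulmxA ND mulmx_coker mul0mx.
rewrite mul_col_mx => /eqP; rewrite col_mx_eq0 => /andP[/eqP Qv /eqP E'v].
have SvE : S *m v = S *m (1%:M - Q) *m v.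
  by rewrite -mulmxA mulmxBl mul1mx Qv subr0.
have key : qf (S^t* *m S) v <= t ^+ 2 * qf 1%:M v.
  rewrite qf_gram SvE -qf_gram SS'.
  have : qf E' v = 0 by rewrite /qf -mulmxA E'v mulmx0 mxE.
  rewrite -ED' qf_spec => /eqP; rewrite psumr_eq0; last first.
    by move=> k _; rewrite mulr_ge0 ?sqm_ge0.
  move=> /allP z; rewrite qf_spec -(qf_unitary v uU') qf1E mulr_sumr ler_sum // => k _.
  have := z k (mem_index_enum k); rewrite /= mulf_eq0.
  case: ltP => [_|st]; rewrite ?oner_eq0 /=; first by move/eqP ->; rewrite !mulr0.
  by move=> _; rewrite ler_wpM2r ?sqm_ge0 // ler_pXn2r ?nnegrE.
have qEv : qf E v = qf 1%:M v.
  by rewrite -{2}Ev -qf_gram Eh EE.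
apply: qf1_eq0; rewrite -qEv; move: key; rewrite SS -qEv -ED !qf_spec => key.
have z0 : \sum_k ((t < s k)%R : bool)%:R * (s k ^+ 2 - t ^+ 2) * sqm ((U *m v) k 0) <= 0.
  have : qf (E *m spec U (fun k => s k ^+ 2) *m E) v = qf (spec U (fun k => s k ^+ 2)) v.
    by rewrite -{2}Ev -qf_conj Eh.
  rewrite -ED !(specM _ _ uU) !qf_spec => H.
  move: key; rewrite -{}H mulr_sumr -subr_le0 -sumrB; apply: le_trans.
  apply: ler_sum => k _ /=; move: (sqm _) => x.
  rewrite le_eqVlt; apply/orP; left; apply/eqP.
  by case: (t < s k)%R => /=; ring.
have nn k : true -> 0 <= ((t < s k)%R : bool)%:R * (s k ^+ 2 - t ^+ 2) * sqm ((U *m v) k 0).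
  move=> _; case: ltP => [ts|_]; last by rewrite !mul0r.
  by rewrite mul1r mulr_ge0 ?sqm_ge0 // subr_ge0 ler_pXn2r ?nnegrE // ltW.
have /eqP : \sum_k ((t < s k)%R : bool)%:R * (s k ^+ 2 - t ^+ 2) * sqm ((U *m v) k 0) = 0.
  by apply/eqP; rewrite eq_le z0 sumr_ge0.
rewrite psumr_eq0 // => /allP z; apply: big1 => k _.
have := z k (mem_index_enum k); rewrite /=.
case: ltP => [ts|_ _]; last by rewrite mul0r.
rewrite mul1r mulf_eq0 subr_eq0 gt_eqF /=; first by move/eqP ->; rewrite mulr0.
by rewrite ltr_pXn2r ?nnegrE.
Qed.

End Projections.

(** * The truncated inequality *)

Section Truncation.
Context {R : realType}.
Local Notation C := R[i].

Lemma abs_isometry n (B : 'M[C]_n) v :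
  qf 1%:M (mxabs B *m v) = qf 1%:M (B *m v).
Proof.
have [U [d [uU aB BB d0]]] := mxabs_spec B.
rewrite -!qf_gram BB aB spec_adj (specM _ _ uU).
by have -> : (fun k => d k ^+ 2) = (fun k => d k * d k) by apply/funext => k.
Qed.

Lemma mxabs_adj n (B : 'M[C]_n) : (mxabs B)^t* = mxabs B.
Proof. by have [U [d [_ -> _ _]]] := mxabs_spec B; exact: spec_adj. Qed.

Lemma qf_mxabs_ge0 n (B : 'M[C]_n) v : 0 <= qf (mxabs B) v.
Proof.
have [U [d [_ -> _ d0]]] := mxabs_spec B.
by rewrite qf_spec sumr_ge0 // => k _; rewrite mulr_ge0 ?sqm_ge0.
Qed.

(** Q is the projection on the range of G, and G' the pseudo-inverse of G. *)
Lemma support_proj n (G : 'M[C]_n) : G^t* = G -> (forall v, 0 <= qf G v) ->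
  exists Q G' : 'M[C]_n, [/\ Q^t* = Q, Q *m Q = Q, G *m Q = G & Q = G' *m G].
Proof.
move=> Gh G0; have [W [g [uW -> g0]]] := psd_spec Gh G0.
have gg k : (g k)^-1 * g k * g k = g k.
  by have [->|gn] := eqVneq (g k) 0; rewrite ?mulr0 // mulVf ?mul1r.
exists (spec W (fun k => (g k)^-1 * g k)), (spec W (fun k => (g k)^-1)); split.
- exact: spec_adj.
- rewrite (specM _ _ uW); apply: eq_spec => k.
  by rewrite mulrCA gg.
- by rewrite (specM _ _ uW); apply: eq_spec => k; rewrite mulrC gg.
- by rewrite (specM _ _ uW).
Qed.

Lemma qf_eigen n (A : 'M[C]_n) (a : R) y :
  A *m y = a%:C *: y -> qf A y = a * qf 1%:M y.
Proof. by move=> Ay; rewrite /qf -mulmxA Ay -scalemxAr mxE ReZ mulmx1. Qed.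

(** If q numbers mu k are positive and have sum at least s q, then the sum of their
    p-th powers is at least that of q copies of s: sum the tangent inequality at
    s. *)
Lemma sum_powR_trunc_ge n (p s : R) (mu : 'I_n -> R) (q : R) :
  1 <= p -> 0 < s ->
  \sum_k ((0 < mu k)%R : bool)%:R = q ->
  s * q <= \sum_k Num.max (mu k) 0 ->
  s `^ p * q <= \sum_k (Num.max (mu k) 0) `^ p.
Proof.
move=> p1 s0 qE sq.
have sp : s `^ (p - 1) * s = s `^ p by rewrite mulrC mulr_powRB1 ?ltW //; lra.
have tang k : p * (s `^ (p - 1) * Num.max (mu k) 0) -
    (p - 1) * s `^ p * ((0 < mu k)%R : bool)%:R <= (Num.max (mu k) 0) `^ p.
  case: (ltP 0 (mu k)) => [mk|mk].
    by rewrite mulr1 lerBlDr powR_tangent // ltW.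
  by rewrite !mulr0 subrr powR_ge0.
apply: le_trans (ler_sum _ (fun k _ => tang k)).
rewrite sumrB -!mulr_sumr qE.
have : s `^ (p - 1) * (s * q) <= s `^ (p - 1) * \sum_k Num.max (mu k) 0.
  by rewrite ler_wpM2l ?powR_ge0.
rewrite mulrA sp => H.
have := ler_wpM2l (le_trans ler01 p1) H; lra.
Qed.

(** The two hypotheses on [qf B] say that B has diagonal blocks s G on the range
    of Q and D on its complement.  Each eigenvector of s G - D lies in one of
    the two subspaces, according to the sign of its eigenvalue; so in this basis
    the diagonal of B lists the eigenvalues of both blocks, and [diag_le_trp]
    applies whatever the off-diagonal blocks are. *)
Lemma trp_block_lower n (p s : R) (G Q D B : 'M[C]_n) :
  1 <= p -> 0 < s -> G^t* = G -> D^t* = D ->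
  Q^t* = Q -> Q *m Q = Q -> G *m Q = G -> D *m Q = 0 ->
  (exists G' : 'M[C]_n, Q = G' *m G) ->
  (forall v, 0 <= qf G v) -> (forall v, 0 <= qf D v) ->
  (\rank Q)%:R <= complex.Re (\tr G) ->
  (forall e, Q *m e = e -> qf B e = s * qf G e) ->
  (forall e, Q *m e = 0 -> qf B e = qf D e) ->
  s `^ p * (\rank Q)%:R + trp p D <= trp p B.
Proof.
move=> p1 s0 Gh Dh Qh QQ GQ DQ [G' QE] G0 D0 rkQ B1 B0.
have QG : Q *m G = G by rewrite -{1}Gh -{1}Qh -adjM GQ.
have QD : Q *m D = 0 by rewrite -{1}Dh -{1}Qh -adjM DQ adj0.
have [|E [mu [uE HE]]] := @herm_spec _ _ (s%:C *: G - D).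
  by rewrite adjD adjN adjZ Gh Dh.
set H := s%:C *: G - D in HE.
have QH : Q *m H = s%:C *: G by rewrite mulmxBr -scalemxAr QG QD subr0.
have HQ : H *m Q = s%:C *: G by rewrite mulmxBl -scalemxAl GQ DQ subr0.
have He k : H *m evec E k = (mu k)%:C *: evec E k by rewrite HE spec_evec.
have DE : (1%:M - Q) *m H = - D by rewrite mulmxBl mul1mx QH addrAC subrr sub0r.
have Qpos k : 0 < mu k -> Q *m evec E k = evec E k.
  move=> mk; apply/eqP; rewrite eq_sym -subr_eq0; apply/eqP/qf1_eq0.
  set y := _ - _; have yE : y = (1%:M - Q) *m evec E k by rewrite mulmxBl mul1mx.
  have Dy : D *m y = (- mu k)%:C *: y.
    rewrite yE mulmxA mulmxBr mulmx1 DQ subr0 -[D]opprK -DE mulNmx -mulmxA He.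
    by rewrite -scalemxAr rmorphN scaleNr.
  have := D0 y; rewrite (qf_eigen Dy) mulNr oppr_ge0 pmulr_rle0 // => y0.
  by apply/eqP; rewrite eq_le y0 qf1_ge0.
have Qneg k : mu k <= 0 -> Q *m evec E k = 0.
  move=> mk; set y := _ *m _.
  have Gy : G *m y = (s^-1 * mu k)%:C *: y.
    have : (s%:C *: G) *m y = (mu k)%:C *: y.
      by rewrite /y mulmxA -scalemxAl GQ -QH -mulmxA He -scalemxAr.
    rewrite -scalemxAl => sGy.
    rewrite -[LHS]scale1r rmorphM -scalerA -sGy scalerA; congr (_ *: _).
    by rewrite -rmorphM mulVf ?gt_eqF.
  have [mz|mn] := eqVneq (mu k) 0.
    move: Gy; rewrite mz mulr0 scale0r => Gy.
    by rewrite /y -QQ -mulmxA -/y QE -mulmxA Gy mulmx0.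
  have {mk} mk : mu k < 0 by rewrite lt_def eq_sym mn.
  apply: qf1_eq0.
  have := G0 y; rewrite (qf_eigen Gy) nmulr_rge0 => [y0|].
    by apply/eqP; rewrite eq_le y0 qf1_ge0.
  by rewrite pmulr_rlt0 ?invr_gt0.
have GE : s%:C *: G = spec E (fun k => Num.max (mu k) 0).
  apply: (spec_ext uE) => k; rewrite -HQ -mulmxA.
  have [mk|mk] := leP (mu k) 0; last by rewrite Qpos.
  by rewrite (Qneg _ mk) mulmx0 scale0r.
have DspE : D = spec E (fun k => Num.max (- mu k) 0).
  apply: (spec_ext uE) => k; rewrite -[D]opprK -DE mulNmx -mulmxA He -scalemxAr.
  rewrite mulmxBl mul1mx; have [mk|mk] := ltP 0 (mu k).
    by rewrite (Qpos _ mk) subrr scaler0 oppr0 max_r ?scale0r // oppr_le0 ltW.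
  by rewrite (Qneg _ mk) subr0 max_l ?oppr_ge0 // rmorphN scaleNr.
have QspE : Q = spec E (fun k => ((0 < mu k)%R : bool)%:R).
  apply: (spec_ext uE) => k; have [mk|mk] := ltP 0 (mu k).
    by rewrite (Qpos _ mk) scale1r.
  by rewrite (Qneg _ mk) scale0r.
have rQ : \sum_k ((0 < mu k)%R : bool)%:R = (\rank Q)%:R :> R.
  rewrite QspE (rank_spec [pred k | 0 < mu k] uE) -sum1_card natr_sum.
  by rewrite [RHS]big_mkcond; apply: eq_bigr => k _; rewrite inE; case: (0 < mu k).
have qB k : `|qf B (evec E k)| = `|mu k|.
  have [mk|mk] := ltP 0 (mu k).
    rewrite B1 ?Qpos // -qfZ GE (qf_evec _ k uE).
    by rewrite max_l // ltW.
  rewrite B0 ?Qneg // DspE (qf_evec _ k uE) max_l ?oppr_ge0 //.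
  by rewrite normrN.
apply: le_trans (diag_le_trp B uE p1).
rewrite [X in trp p X]DspE trp_spec //; last by move=> k; rewrite le_max lexx orbT.
have trG : s * (\rank Q)%:R <= \sum_k Num.max (mu k) 0.
  rewrite -(tr_spec _ uE) -GE mxtraceZ ReZ ler_wpM2l // ltW //.
have := sum_powR_trunc_ge p1 s0 rQ trG; rewrite -(lerD2r (\sum_k Num.max (- mu k) 0 `^ p)).
move=> /le_trans; apply; rewrite -big_split /=; apply: ler_sum => k _.
have p0 : p != 0 by rewrite gt_eqF //; lra.
rewrite qB; have [mk|mk] := ltP 0 (mu k).
  have nm : - mu k <= 0 by rewrite oppr_le0 ltW.
  by rewrite (max_r nm) (powR0 p0) addr0 gtr0_norm.
have nm : 0 <= - mu k by rewrite oppr_ge0.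
by rewrite (max_l nm) (powR0 p0) add0r ler0_norm.
Qed.

Lemma funcalc_mxabs n (f : R -> R) (A : 'M[C]_n) :
  exists U d, [/\ U \is unitarymx, mxabs A = spec U d,
    funcalc f (mxabs A) = spec U (f \o d),
    A^t* *m A = spec U (fun k => d k ^+ 2) & forall k, 0 <= d k].
Proof.
have [U [d [uU aA AA d0]]] := mxabs_spec A; exists U, d.
split; [exact: uU|exact: aA| |exact: AA|exact: d0].
by rewrite aA; exact: funcalc_spec.
Qed.

Lemma funcalc_adj n (f : R -> R) (A : 'M[C]_n) :
  (funcalc f (mxabs A))^t* = funcalc f (mxabs A).
Proof. by have [U [d [_ _ -> _ _]]] := funcalc_mxabs f A; exact: spec_adj. Qed.

Lemma qf_funcalc_ge0 n (f : R -> R) (A : 'M[C]_n) v :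
  (forall x, 0 <= x -> 0 <= f x) -> 0 <= qf (funcalc f (mxabs A)) v.
Proof.
move=> f0; have [U [d [_ _ -> _ d0]]] := funcalc_mxabs f A.
rewrite qf_spec sumr_ge0 // => k _; rewrite mulr_ge0 ?sqm_ge0 //.
exact/f0/d0.
Qed.

Definition cut (s x : R) : R := Num.min x s.
(** Applied to a positive matrix, this gives the spectral projection for ]s, +oo[. *)
Definition above (s x : R) : R := ((s < x)%R : bool)%:R.

Lemma qf_proj_compl n (Q : 'M[C]_n) v : Q^t* = Q -> Q *m Q = Q ->
  qf 1%:M ((1%:M - Q) *m v) <= qf 1%:M v.
Proof.
move=> Qh QQ; rewrite -qf_gram adjD adjN adj1 Qh mulmxBr mulmx1 mulmxBl mul1mx QQ.
rewrite subrr subr0 qfB lerBlDr lerDl -{1}QQ -{1}Qh qf_gram; exact: qf1_ge0.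
Qed.

(** P v and (1 - Q) w are orthogonal because P <= Q, and K is a contraction, so
    the squared norm is at most s^2 ||P v||^2 + ||A (1 - P) v||^2. *)
Lemma cut_dominates n (s : R) (A Q K : 'M[C]_n) : 0 < s ->
  let P := funcalc (above s) (mxabs A) in
  Q^t* = Q -> Q *m Q = Q -> P *m Q = P ->
  (forall v, qf 1%:M (K *m v) <= qf 1%:M v) ->
  forall v, qf 1%:M ((s%:C *: P + (1%:M - Q) *m K *m A *m (1%:M - P)) *m v)
    <= qf 1%:M (funcalc (cut s) (mxabs A) *m v).
Proof.
move=> s0 P Qh QQ PQ cK v; rewrite {}/P in PQ *.
have [U [d [uU aA PE AA d0]]] := funcalc_mxabs (above s) A.
have FE : funcalc (cut s) (mxabs A) = spec U (cut s \o d).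
  by rewrite aA; exact: funcalc_spec.
move: PQ; move: (funcalc (above s) _) PE => P PE PQ.
have Ph : P^t* = P by rewrite PE; exact: spec_adj.
have P'E : 1%:M - P = spec U (fun k => 1 - above s (d k)).
  rewrite -(spec1 uU) PE -[- spec _ _]scaleN1r.
  have -> : -1 = (-1)%:C :> C by rewrite rmorphN rmorph1.
  by rewrite specZ specD; apply: eq_spec => k /=; rewrite mulN1r.
have PQ' : P *m (1%:M - Q) = 0 by rewrite mulmxBr mulmx1 PQ subrr.
set L := (1%:M - Q) *m K *m A *m (1%:M - P).
have PL : P^t* *m L = 0.
  by rewrite Ph /L !mulmxA PQ' !mul0mx.
have LP : L^t* *m P = 0.
  by rewrite -[LHS]trmxCK adjM trmxCK PL adj0.
have -> : qf 1%:M ((s%:C *: P + L) *m v) = s ^+ 2 * qf (P *m P) v + qf 1%:M (L *m v).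
  rewrite -!qf_gram adjD adjZ mulmxDl !mulmxDr -!scalemxAl -!scalemxAr.
  by rewrite PL LP !scaler0 addr0 add0r qfD !qfZ Ph expr2 mulrA.
have -> : L *m v = (1%:M - Q) *m (K *m (A *m ((1%:M - P) *m v))).
  by rewrite /L -!mulmxA.
rewrite FE.
have h1 := qf_proj_compl (K *m (A *m ((1%:M - P) *m v))) Qh QQ.
have {h1} h1 := le_trans h1 (cK _).
apply: le_trans (lerD (lexx _) h1) _.
have -> : qf 1%:M (A *m ((1%:M - P) *m v)) =
          qf (spec U (fun k => (1 - above s (d k)) * d k ^+ 2 * (1 - above s (d k)))) v.
  by rewrite -qf_gram AA -qf_conj P'E spec_adj 2!(specM _ _ uU).
rewrite PE (specM _ _ uU) -[X in _ <= X]qf_gram spec_adj (specM _ _ uU).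
rewrite !qf_spec mulr_sumr -big_split; apply: ler_sum => k _.
rewrite /= mulrA -mulrDl ler_wpM2r ?sqm_ge0 // /above /cut.
by case: (ltP s (d k)) => sd; rewrite /= ?subrr ?subr0 ?mulr0 ?mul0r ?mulr1 ?mul1r ?addr0 ?add0r expr2.
Qed.

End Truncation.

Section TruncationBound.
Context {R : realType}.
Local Notation C := R[i].

Lemma above_idem n (s : R) (A : 'M[C]_n) :
  let P := funcalc (above s) (mxabs A) in P *m P = P.
Proof.
have [U [d [uU _ -> _ _]]] := funcalc_mxabs (above s) A.
rewrite /= (specM _ _ uU); apply: eq_spec => k /=.
by rewrite /above; case: (s < d k); rewrite ?mulr1 ?mulr0.
Qed.

Lemma rank_above n (s : R) (A : 'M[C]_n) :
  let P := funcalc (above s) (mxabs A) in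
  (\rank P)%:R = complex.Re (\tr P).
Proof.
have [U [d [uU _ -> _ _]]] := funcalc_mxabs (above s) A.
rewrite /= tr_spec // (rank_spec [pred k | s < d k] uU) -sum1_card natr_sum.
by rewrite big_mkcond; apply: eq_bigr => k _; rewrite inE /above /=; case: (s < d k).
Qed.

Lemma Re_tr_sum n (I : Type) (r : seq I) (F : I -> 'M[C]_n) :
  complex.Re (\tr (\sum_(k <- r) F k)) = \sum_(k <- r) complex.Re (\tr (F k)).
Proof.
elim/big_rec2: _ => [|k y x _ <-]; first by rewrite mxtrace0.
by rewrite mxtraceD ReD.
Qed.

Lemma rank_sum_le n m (F : 'I_m -> 'M[C]_n) :
  (\rank (\sum_j F j)%R <= \sum_j \rank (F j))%N.
Proof.
elim/big_ind2: _ => [|x1 x2 y1 y2 h1 h2|j _] //; first by rewrite mxrank0.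
exact: (leq_trans (mxrank_add x1 y1) (leq_add h1 h2)).
Qed.

(** Interlacing, turned into a comparison of the sums of cut(sigma)^p. *)
Lemma cut_sum_le n (p s : R) (S Q : 'M[C]_n) : 1 <= p -> 0 < s ->
  trp p (funcalc (cut s) (mxabs S)) <=
  s `^ p * (\rank Q)%:R + trp p (mxabs (S *m (1%:M - Q))).
Proof.
move=> p1 s0.
have p0 : p != 0 by rewrite gt_eqF //; lra.
have [U [d [uU aS -> SS d0]]] := funcalc_mxabs (cut s) S.
have [U' [d' [uU' aS' SS' d'0]]] := mxabs_spec (S *m (1%:M - Q)).
have cut0 (x : R) : 0 <= x -> 0 <= cut s x.
  by move=> x0; rewrite /cut le_min x0 (ltW s0).
have dcut0 k : 0 <= (cut s \o d) k by exact: cut0.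
rewrite aS' (trp_spec p uU dcut0) (trp_spec p uU' d'0).
have -> : \sum_k (cut s \o d) k `^ p = \sum_(x <- [seq d k | k <- enum 'I_n]) cut s x `^ p.
  by rewrite big_map big_enum.
apply: (@le_trans _ _ (s `^ p * (\rank Q)%:R +
          \sum_(x <- [seq d' k | k <- enum 'I_n]) cut s x `^ p)); last first.
  rewrite lerD2l big_map big_enum; apply: ler_sum => k _.
  apply: ge0_ler_powR; rewrite ?nnegrE ?cut0 //; first lra.
  by rewrite /cut ge_min lexx.
apply: count_le_sum.
- by rewrite /cut (min_l (ltW s0)) powR0.
- move=> x x0; rewrite powR_ge0 /=; apply: ge0_ler_powR; rewrite ?nnegrE ?cut0 ?(ltW s0) //.
    by lra.
  by rewrite /cut ge_min lexx orbT.
- move=> x y x0 xy; have y0 := le_trans x0 xy.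
  apply: ge0_ler_powR; rewrite ?nnegrE ?cut0 //; first by lra.
  by rewrite /cut le_min !ge_min xy lexx orbT.
- by apply/allP => x /mapP[k _ ->].
- by apply/allP => x /mapP[k _ ->].
- move=> t t0.
  have cnt (e : 'I_n -> R) :
      count (> t)%R [seq e k | k <- enum 'I_n] = #|[pred k | (t < e k)%R]|.
    by rewrite -sum1_count big_map big_enum_cond /= -sum1_card.
  by rewrite !cnt; exact: interlacing_count uU uU' SS SS' d0 d'0 t0.
Qed.

Lemma qf_compl_mul n (Q X : 'M[C]_n) e : Q^t* = Q ->
  qf ((1%:M - Q) *m X) e = qf X e - complex.Re (((Q *m e)^t* *m X *m e) 0 0).
Proof.
move=> Qh; rewrite mulmxBl mul1mx qfB; congr (_ - _).
by rewrite /qf adjM Qh !mulmxA.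
Qed.

(** The matrices B_j are those of Step 1 above, with K = V^* from the polar
    decomposition of S (1 - Q). *)
Lemma cut_bound n m (p s kappa : R) (A : 'I_m -> 'M[C]_n) :
  1 <= p -> 0 < s -> 0 <= kappa ->
  (forall B : 'I_m -> 'M[C]_n,
     trp p (\sum_j B j) <= kappa * trp p (\sum_j mxabs (B j))) ->
  trp p (funcalc (cut s) (mxabs (\sum_j A j))) <=
  kappa * trp p (\sum_j funcalc (cut s) (mxabs (A j))).
Proof.
move=> p1 s0 k0 lin.
pose P j := funcalc (above s) (mxabs (A j)).
have Ph j : (P j)^t* = P j by exact: funcalc_adj.
have PP j : P j *m P j = P j by exact: above_idem.
have qP j v : qf (P j) v = qf 1%:M (P j *m v).
  by rewrite -qf_gram Ph PP.
have [G GE] : exists G, G = \sum_j P j by eexists.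
have Gh : G^t* = G.
  by rewrite GE adj_sum; apply: eq_bigr => j _; exact: Ph.
have G0 v : 0 <= qf G v.
  by rewrite GE qf_sum sumr_ge0 // => j _; rewrite qP qf1_ge0.
have [Q [G' [Qh QQ GQ QE]]] := support_proj Gh G0.
have PQ j : P j *m Q = P j.
  apply/eqP; rewrite eq_sym -subr_eq0 -[X in X - _]mulmx1 -mulmxBr; apply/eqP.
  apply: mx_ext => v; rewrite mul0mx -mulmxA; apply: qf1_eq0.
  have : qf G ((1%:M - Q) *m v) = 0.
    have Gw : G *m ((1%:M - Q) *m v) = 0.
      by rewrite mulmxA mulmxBr mulmx1 GQ subrr mul0mx.
    by rewrite /qf -mulmxA Gw mulmx0 mxE.
  rewrite GE qf_sum => /eqP; rewrite psumr_eq0 => [/allP z|i _].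
    by rewrite -qP; apply/eqP/z; rewrite mem_index_enum.
  by rewrite qP qf1_ge0.
have [S SE] : exists S, S = \sum_j A j by eexists.
rewrite -SE.
have [V [_ VM cV cVa]] := polar (S *m (1%:M - Q)).
have [D DE] : exists D, D = mxabs (S *m (1%:M - Q)) by eexists.
rewrite -DE in VM.
pose B j := s%:C *: P j + (1%:M - Q) *m V^t* *m A j *m (1%:M - P j).
have Dh : D^t* = D by rewrite DE; exact: mxabs_adj.
have DQ : D *m Q = 0.
  apply: mx_ext => v; rewrite mul0mx -mulmxA; apply: qf1_eq0.
  rewrite DE abs_isometry mulmxA -(mulmxA S) mulmxBl mul1mx QQ subrr mulmx0 mul0mx.
  by rewrite qf1E big1 // => k _; rewrite mxE sqmE /= expr0n addr0.
(* lower bound for the sum of the B_j, through its diagonal blocks *)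
apply: le_trans (cut_sum_le S Q p1 s0) _; rewrite -DE.
apply: (@le_trans _ _ (trp p (\sum_j B j))).
  have qBE e : qf (\sum_j B j) e = s * qf G e +
      qf ((1%:M - Q) *m (V^t* *m \sum_j (A j *m (1%:M - P j)))) e.
    rewrite GE !mulmx_sumr !qf_sum mulr_sumr -big_split; apply: eq_bigr => j _.
    by rewrite /B qfD qfZ !mulmxA.
  apply: (trp_block_lower (G := G) (D := D) p1 s0 Gh Dh Qh QQ GQ DQ).
  - by exists G'.
  - exact: G0.
  - by move=> v; rewrite DE qf_mxabs_ge0.
  - apply: (@le_trans _ _ (\rank G)%:R); first by rewrite ler_nat QE mxrankM_maxr.
    apply: (@le_trans _ _ (\sum_j \rank (P j))%:R).
      by rewrite ler_nat GE rank_sum_le.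
    rewrite natr_sum GE Re_tr_sum; apply: ler_sum => j _.
    by rewrite rank_above.
  - move=> e Qe; rewrite qBE; apply/eqP; rewrite -subr_eq0 addrAC subrr add0r.
    rewrite /qf !mulmxA -[X in X^t* *m _]Qe adjM Qh -(mulmxA (e^t* )).
    by rewrite mulmxBr mulmx1 QQ subrr mulmx0 !mul0mx mxE.
  - move=> e Qe; rewrite qBE qf_compl_mul // Qe adj0 !mul0mx mxE subr0.
    have -> : qf G e = 0 by rewrite /qf -GQ -!mulmxA Qe !mulmx0 mxE.
    rewrite mulr0 add0r -VM /qf -!mulmxA mulmxBl Qe mul1mx subr0.
    congr (complex.Re ((_ *m (_ *m _)) 0 0)); rewrite SE !mulmx_suml.
    apply: eq_bigr => j _; rewrite -mulmxA mulmxBl mul1mx.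
    by rewrite -PQ -mulmxA Qe mulmx0 subr0.
apply: (le_trans (lin B)); apply: (ler_wpM2l k0).
have F0 (x : R) : 0 <= x -> 0 <= cut s x.
  by move=> x0; rewrite /cut le_min x0 (ltW s0).
apply: (trp_mono p1).
- by rewrite adj_sum; apply: eq_bigr => j _; exact: mxabs_adj.
- by move=> v; rewrite qf_sum sumr_ge0 // => j _; exact: qf_mxabs_ge0.
move=> v; rewrite !qf_sum; apply: ler_sum => j _; apply: abs_mono.
- exact: funcalc_adj.
- by move=> w; exact: qf_funcalc_ge0.
- by move=> w; apply: cut_dominates; [exact: s0|exact: Qh|exact: QQ|exact: PQ|exact: cVa].
Qed.

End TruncationBound.

(** * Operator concavity of powers *)

Section PowerConcavity.
Context {R : realType}.
Local Notation C := R[i].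

(** The algebraic laws of the powers Y^r of a positive definite matrix; the
    midpoint argument below uses Y^r through them only. *)
Definition power_family n (Y : R -> 'M[C]_n) :=
  [/\ Y 0 = 1%:M, forall r s, Y r *m Y s = Y (r + s) & forall r, (Y r)^t* = Y r].

Definition spow n (U : 'M[C]_n) (d : 'I_n -> R) (r : R) := spec U (fun k => d k `^ r).

Lemma spow_family n (U : 'M[C]_n) d : U \is unitarymx -> (forall k, 0 < d k) ->
  power_family (spow U d).
Proof.
move=> uU d0; split.
- by rewrite -(spec1 uU); apply: eq_spec => k; rewrite powRr0.
- move=> r s; rewrite /spow (specM _ _ uU); apply: eq_spec => k.
  by rewrite powRD // (gt_eqF (d0 k)) implybT.
- by move=> r; exact: spec_adj.
Qed.

Lemma spow1 n (U : 'M[C]_n) d : (forall k, 0 <= d k) -> spow U d 1 = spec U d.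
Proof. by move=> d0; apply: eq_spec => k; rewrite powRr1. Qed.

Lemma qf_half n (Y : R -> 'M[C]_n) r v : power_family Y ->
  qf (Y r) v = qf 1%:M (Y (r / 2) *m v).
Proof.
move=> [_ YM Yh]; rewrite -qf_gram Yh YM.
by have -> : r / 2 + r / 2 = r by field.
Qed.

Lemma qf_family_ge0 n (Y : R -> 'M[C]_n) r v : power_family Y -> 0 <= qf (Y r) v.
Proof. by move=> Yf; rewrite (qf_half _ _ Yf) qf1_ge0. Qed.

Lemma cross_half n (Y : R -> 'M[C]_n) a b (x v : 'cV[C]_n) : power_family Y ->
  x^t* *m Y ((a + b) / 2) *m v = (Y (a / 2) *m x)^t* *m (Y (b / 2) *m v).
Proof.
move=> [_ YM Yh].
have -> : Y ((a + b) / 2) = Y (a / 2) *m Y (b / 2).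
  by rewrite YM; congr Y; field.
by rewrite adjM Yh !mulmxA.
Qed.

Lemma qf_scale n (M : 'M[C]_n) (a : R) v : qf M (a%:C *: v) = a ^+ 2 * qf M v.
Proof.
rewrite /qf adjZ -!scalemxAl -scalemxAr !mxE !ReZ.
by rewrite expr2 mulrA.
Qed.

(** The hypothesis says that the block matrix with diagonal al^2 Z^a, be^2 Z^b and
    off-diagonal entry T is positive; the conclusion bounds T by the geometric
    mean of the diagonal blocks.  For an eigenvector u of
    Z^(-m/2) T Z^(-m/2), where m = (a + b) / 2, the vectors below are chosen so
    that all three terms become multiples of u^* Z^(m-a) u. *)
Lemma geometric_mean_bound n (Z : R -> 'M[C]_n) (T : 'M[C]_n) (a b al be : R) :
  power_family Z -> T^t* = T -> 0 < al -> 0 < be ->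
  (forall x y : 'cV[C]_n, 2 * complex.Re ((x^t* *m T *m y) 0 0) <=
     al ^+ 2 * qf (Z a) x + be ^+ 2 * qf (Z b) y) ->
  forall v, qf T v <= al * be * qf (Z ((a + b) / 2)) v.
Proof.
move=> Zf Th al0 be0 H v; set m := (a + b) / 2.
have [Z0 ZM Zh] := Zf.
have Zpos r u : qf 1%:M u = 1 -> 0 < qf (Z r) u.
  move=> u1; rewrite lt_def (qf_family_ge0 _ _ Zf) andbT; apply/eqP => q0.
  have u0 : u = 0.
    have -> : u = Z (- (r / 2)) *m (Z (r / 2) *m u).
      by rewrite mulmxA ZM addNr Z0 mul1mx.
    by rewrite [Z (r / 2) *m u]qf1_eq0 ?mulmx0 // -(qf_half _ _ Zf).
  move: u1; rewrite u0 qf1E big1 => [|k _]; first by move/eqP; rewrite eq_sym oner_eq0.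
  by rewrite mxE sqmE /= expr0n addr0.
have [|E [nu [uE NE]]] := @herm_spec _ _ (Z (- (m / 2)) *m T *m Z (- (m / 2))).
  by rewrite !adjM Zh Th mulmxA.
have TE : T = Z (m / 2) *m spec E nu *m Z (m / 2).
  rewrite -NE !mulmxA ZM subrr Z0 mul1mx -mulmxA ZM addNr Z0 mulmx1.
  by [].
have nu_le k : nu k <= al * be.
  set u := evec E k; have u1 : qf 1%:M u = 1 by exact: qf1_evec.
  have Nu : spec E nu *m u = (nu k)%:C *: u by exact: spec_evec.
  (* the factors be and al balance the two terms on the right *)
  have := H (be%:C *: (Z (m / 2 - a) *m u))
            (al%:C *: (Z (- (m / 2)) *m u)).
  rewrite !qf_scale.
  have qa : qf (Z a) (Z (m / 2 - a) *m u) = qf (Z (m - a)) u.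
    rewrite -qf_conj Zh !ZM; congr qf; congr Z; by field.
  have qb : qf (Z b) (Z (- (m / 2)) *m u) = qf (Z (m - a)) u.
    rewrite -qf_conj Zh !ZM; congr qf; congr Z; by rewrite /m; field.
  rewrite qa qb adjZ -!scalemxAl -scalemxAr mxE ReZ mxE ReZ.
  have -> : ((Z (m / 2 - a) *m u)^t* *m T *m (Z (- (m / 2)) *m u)) =
            (nu k)%:C *: (u^t* *m Z (m - a) *m u).
    move: (spec E nu) TE Nu => N TE Nu.
    rewrite adjM Zh TE -!mulmxA (mulmxA (Z (m / 2)) (Z (- _))) ZM subrr Z0 mul1mx Nu.
    rewrite -!scalemxAr (mulmxA (Z _) (Z _)) ZM.
    by have -> : m / 2 - a + m / 2 = m - a by field.
  rewrite mxE ReZ -/(qf (Z (m - a)) u).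
  have := Zpos (m - a) u u1; move: (qf (Z (m - a)) u) (nu k) => kap x kap0 h.
  have xyk : 0 < al * be * kap by rewrite !mulr_gt0.
  by rewrite -(ler_pM2l xyk); clear - h; lra.
rewrite TE.
have -> : qf (Z (m / 2) *m spec E nu *m Z (m / 2)) v = qf (spec E nu) (Z (m / 2) *m v).
  by rewrite -qf_conj Zh.
have -> : qf (Z m) v = qf 1%:M (Z (m / 2) *m v).
  rewrite -qf_gram Zh ZM; by have -> : m / 2 + m / 2 = m by field.
rewrite qf_spec -(qf_unitary (Z (m / 2) *m v) uE) qf1E mulr_sumr.
by apply: ler_sum => k _; rewrite ler_wpM2r ?sqm_ge0.
Qed.

Lemma powR_inv_le (M x r : R) : 0 < x -> 1 <= M -> x^-1 <= M -> 0 <= r <= 1 ->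
  M^-1 <= x `^ r.
Proof.
move=> x0 M1 xM /andP[r0 r1]; have M0 : 0 < M by lra.
have -> : x `^ r = ((x^-1) `^ r)^-1.
  by rewrite -(powR_inv1 (ltW x0)) -powRrM mulN1r powRN invrK.
rewrite lef_pV2 ?posrE ?powR_gt0 ?invr_gt0 //.
apply: (@le_trans _ _ (M `^ r)).
  by apply: ge0_ler_powR; rewrite ?nnegrE ?invr_ge0 ?(ltW x0) ?(ltW M0).
exact: ler1_powR.
Qed.

Lemma powR_le_add1 (x r : R) : 0 <= x -> 0 <= r <= 1 -> x `^ r <= 1 + x.
Proof.
move=> x0 /andP[r0 r1]; have [x1|x1] := leP 1 x.
  by apply: le_trans (ler1_powR x1 r1) _; rewrite lerDr.
have [->|xn0] := eqVneq x 0.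
  have [->|rn0] := eqVneq r 0; first by rewrite powRr0 addr0.
  by rewrite powR0 // addr0.
apply: (@le_trans _ _ 1); last by rewrite lerDl.
rewrite -[X in _ <= X](powRr0 x); apply: ger_powR => //.
by rewrite lt_def xn0 x0 ltW.
Qed.

Lemma le_halving (a q e : R) : 0 <= e -> (forall k, a <= q + e / 2 ^+ k) -> a <= q.
Proof.
move=> e0 H; rewrite leNgt; apply/negP => qa.
have aq : 0 < a - q by rewrite subr_gt0.
pose N := Num.bound (e / (a - q)).
have h1 : e / (a - q) < N%:R by apply: archi_boundP; rewrite divr_ge0 // ltW.
have h2 : (N%:R : R) <= 2 ^+ N by rewrite -natrX ler_nat ltnW // ltn_expl.
have := H N; rewrite -lerBlDl leNgt => /negP; apply.
rewrite ltr_pdivrMr ?exprn_gt0 // mulrC -ltr_pdivrMr //.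
exact: lt_le_trans h1 h2.
Qed.

Lemma weighted_amgm (A B c X Y : R) : 0 <= A -> 0 <= B -> 0 <= X -> 0 <= Y ->
  c ^+ 2 <= X * Y -> 2 * (A * B * c) <= A ^+ 2 * X + B ^+ 2 * Y.
Proof.
move=> A0 B0 X0 Y0 cXY.
have h1 : (A * B * c) ^+ 2 <= ((A ^+ 2 * X + B ^+ 2 * Y) / 2) ^+ 2.
  apply: (@le_trans _ _ (A ^+ 2 * X * (B ^+ 2 * Y))).
    have -> : (A * B * c) ^+ 2 = A ^+ 2 * B ^+ 2 * c ^+ 2 by ring.
    have -> : A ^+ 2 * X * (B ^+ 2 * Y) = A ^+ 2 * B ^+ 2 * (X * Y) by ring.
    by rewrite ler_wpM2l // mulr_ge0 // sqr_ge0.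
  by have := sqr_ge0 (A ^+ 2 * X - B ^+ 2 * Y); lra.
have pos : 0 <= (A ^+ 2 * X + B ^+ 2 * Y) / 2.
  by rewrite divr_ge0 // addr_ge0 // mulr_ge0 // sqr_ge0.
have : A * B * c <= (A ^+ 2 * X + B ^+ 2 * Y) / 2.
  apply: le_trans (ler_norm _) _.
  by rewrite -(@ler_pXn2r _ 2) ?nnegrE // real_normK ?num_real.
lra.
Qed.

Lemma low_exponent (r : R) : 0 <= r -> r <= 1 / 2 ->
  [/\ 0 <= (0 : R) <= 1, 0 <= 2 * r <= 1 & 0 + 2 * r < 2].
Proof. by move=> r0 r1; split; lra. Qed.

Lemma high_exponent (r : R) : 1 / 2 < r -> r < 1 ->
  [/\ 0 <= 2 * r - 1 <= 1, 0 <= (1 : R) <= 1 & 2 * r - 1 + 1 < 2].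
Proof. by move=> r0 r1; split; lra. Qed.

(** T r is the sum of the w_i^(1-r) Y_i^r.  The target T r <= wt^(1-r) Z^r is an
    equality at r = 0 and at r = 1.  An inequality with a factor c at both ends of
    an interval passes to its midpoint with the geometric mean of the factors.
    Every r in [0, 1] is the midpoint of 0 and 2r or of 2r - 1 and 1, so if the
    inequality holds on [0, 1] with a factor c, it holds with sqrt c.  Iterating
    from a crude bound sends the factor to 1. *)
Section Weighted.
Variables (n l : nat) (Y : 'I_l -> R -> 'M[C]_n) (w : 'I_l -> R) (Z : R -> 'M[C]_n).
Variables (M K : R).
Hypotheses (Yf : forall i, power_family (Y i)) (Zf : power_family Z).
Hypothesis w0 : forall i, 0 <= w i.
Hypothesis ZE : \sum_i Y i 1 = Z 1.
Let wt := \sum_i w i.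
Hypothesis wt0 : 0 < wt.
Hypotheses (K0 : 0 <= K) (M0 : 0 <= M).
Hypothesis Y_le : forall i r v, 0 <= r <= 1 -> qf (Y i r) v <= K * qf 1%:M v.
Hypothesis Z_ge : forall r v, 0 <= r <= 1 -> qf 1%:M v <= M * qf (Z r) v.

Let T r := \sum_i (w i `^ (1 - r))%:C *: Y i r.

Let qT r v : qf (T r) v = \sum_i w i `^ (1 - r) * qf (Y i r) v.
Proof. by rewrite /T qf_sum; apply: eq_bigr => i _; exact: qfZ. Qed.

Let T_adj r : (T r)^t* = T r.
Proof.
rewrite /T adj_sum; apply: eq_bigr => i _; rewrite adjZ.
by have [_ _ ->] := Yf i.
Qed.

Let T0 v : qf (T 0) v = wt * qf (Z 0) v.
Proof.
have [-> _ _] := Zf; rewrite qT /wt mulr_suml; apply: eq_bigr => i _.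
by have [-> _ _] := Yf i; rewrite subr0 powRr1.
Qed.

Let T1 v : qf (T 1) v = qf (Z 1) v.
Proof.
rewrite -ZE qT qf_sum; apply: eq_bigr => i _.
by rewrite subrr powRr0 mul1r.
Qed.

Let T_cross a b (x v : 'cV[C]_n) : 0 <= a <= 1 -> 0 <= b <= 1 -> a + b < 2 ->
  2 * complex.Re ((x^t* *m T ((a + b) / 2) *m v) 0 0) <= qf (T a) x + qf (T b) v.
Proof.
move=> ha hb ab.
have -> : complex.Re ((x^t* *m T ((a + b) / 2) *m v) 0 0) =
    \sum_i w i `^ (1 - (a + b) / 2) *
      complex.Re (((Y i (a / 2) *m x)^t* *m (Y i (b / 2) *m v)) 0 0).
  rewrite /T mulmx_sumr mulmx_suml summxE Re_sum; apply: eq_bigr => i _.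
  by rewrite -(cross_half a b x v (Yf i)) -scalemxAr -scalemxAl mxE ReZ.
rewrite !qT mulr_sumr -big_split; apply: ler_sum => i _ /=.
rewrite !(qf_half _ _ (Yf i)).
have := le_trans (sqm_Re _) (cauchy_schwarz (Y i (a / 2) *m x) (Y i (b / 2) *m v)).
have := qf1_ge0 (Y i (a / 2) *m x); have := qf1_ge0 (Y i (b / 2) *m v).
move: (complex.Re _) (qf _ (Y i (a / 2) *m x)) (qf _ (Y i (b / 2) *m v)).
move=> c X X' X'0 X0 cX.
have -> : w i `^ (1 - (a + b) / 2) = w i `^ ((1 - a) / 2) * w i `^ ((1 - b) / 2).
  rewrite -powRD; first by congr (_ `^ _); field.
  by apply/implyP => /eqP; lra.
have sq r : w i `^ (1 - r) = w i `^ ((1 - r) / 2) ^+ 2.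
  by rewrite -powR_mulrn ?powR_ge0 // -powRrM; congr (_ `^ _); field.
rewrite (sq a) (sq b).
have := powR_ge0 (w i) ((1 - a) / 2); have := powR_ge0 (w i) ((1 - b) / 2).
move: (w i `^ ((1 - a) / 2)) (w i `^ ((1 - b) / 2)) => A B B0 A0.
exact: weighted_amgm.
Qed.

Let bounded c := forall r v, 0 <= r <= 1 ->
  qf (T r) v <= c * (wt `^ (1 - r) * qf (Z r) v).

Let bounded_sqrt e : 0 <= e -> bounded (1 + e) -> bounded (1 + e / 2).
Proof.
move=> e0 He r v /andP[r0].
rewrite le_eqVlt => /predU1P[->|r1].
  rewrite T1 subrr powRr0 mul1r ler_peMl ?(qf_family_ge0 _ _ Zf) //; lra.
have se1 : Num.sqrt (1 + e) <= 1 + e / 2.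
  rewrite -(@ler_pXn2r _ 2) ?nnegrE ?sqrtr_ge0 //; last by lra.
  by rewrite sqr_sqrtr; [have := sqr_ge0 e|]; lra.
have se0 : 0 < Num.sqrt (1 + e) by rewrite sqrtr_gt0; lra.
suff H : qf (T r) v <= Num.sqrt (1 + e) * (wt `^ (1 - r) * qf (Z r) v).
  apply: le_trans H _; rewrite ler_wpM2r //.
  by rewrite mulr_ge0 ?powR_ge0 ?(qf_family_ge0 _ _ Zf).
have sq s : wt `^ s = (wt `^ (s / 2)) ^+ 2.
  by rewrite -powR_mulrn ?powR_ge0 // -powRrM; congr (_ `^ _); field.
have wp s : 0 < wt `^ s by rewrite powR_gt0.
have wD s t : wt `^ s * wt `^ t = wt `^ (s + t).
  by rewrite powRD // (gt_eqF wt0) implybT.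
have ss : Num.sqrt (1 + e) ^+ 2 = 1 + e by rewrite sqr_sqrtr; lra.
have [rh|rh] := leP r (1 / 2).
  have rE : (0 + 2 * r) / 2 = r by field.
  have wE : wt `^ (1 / 2) * (Num.sqrt (1 + e) * wt `^ ((1 - 2 * r) / 2)) =
            Num.sqrt (1 + e) * wt `^ (1 - r).
    by rewrite mulrCA wD; congr (_ * _ `^ _); field.
  have G := @geometric_mean_bound n Z (T r) 0 (2 * r) _ _ Zf (T_adj r)
    (wp (1 / 2)) (mulr_gt0 se0 (wp ((1 - 2 * r) / 2))).
  rewrite mulrA -wE; rewrite rE in G; apply: G => x y.
  have := @T_cross 0 (2 * r) x y; rewrite rE => cr.
  have [h1 h2 h3] := low_exponent r0 rh.
  apply: (le_trans (cr h1 h2 h3)).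
  rewrite exprMn ss -!sq T0; apply: lerD; first by rewrite powRr1 // ltW.
  by rewrite -mulrA; exact: He.
have rE : ((2 * r - 1) + 1) / 2 = r by field.
have wE : Num.sqrt (1 + e) * wt `^ ((1 - (2 * r - 1)) / 2) * 1 =
          Num.sqrt (1 + e) * wt `^ (1 - r).
  by rewrite mulr1; congr (_ * _ `^ _); field.
have G := @geometric_mean_bound n Z (T r) (2 * r - 1) 1 _ _ Zf (T_adj r)
  (mulr_gt0 se0 (wp ((1 - (2 * r - 1)) / 2))) ltr01.
rewrite mulrA -wE; rewrite rE in G; apply: G => x y.
have := @T_cross (2 * r - 1) 1 x y; rewrite rE => cr.
have [h1 h2 h3] := high_exponent rh r1.
apply: (le_trans (cr h1 h2 h3)).
rewrite exprMn ss -!sq T1; apply: lerD; last by rewrite expr1n mul1r.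
by rewrite -mulrA; exact: He.
Qed.

Let bounded_some : exists2 e, 0 <= e & bounded (1 + e).
Proof.
pose m := 1 + wt^-1; pose k := \sum_i (1 + w i) * K.
have wi0 : 0 <= wt^-1 by rewrite invr_ge0 ltW.
have k0 : 0 <= k by rewrite sumr_ge0 // => i _; rewrite mulr_ge0 // addr_ge0.
have m0 : 0 < m by rewrite /m; lra.
exists (k * (m * M)); first by rewrite !mulr_ge0 // ltW.
move=> r v r01; have r01' : 0 <= 1 - r <= 1 by lra.
have up : qf (T r) v <= k * qf 1%:M v.
  rewrite qT mulr_suml; apply: ler_sum => i _; rewrite -mulrA.
  apply: ler_pM; rewrite ?powR_ge0 ?(qf_family_ge0 _ _ (Yf i)) //.
    exact: powR_le_add1.
  exact: Y_le.
have lw : 1 <= m * wt `^ (1 - r).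
  rewrite -ler_pdivrMl // mulr1; apply: powR_inv_le => //; rewrite /m; lra.
have q0 := qf_family_ge0 r v Zf.
apply: le_trans up _.
apply: (@le_trans _ _ (k * (m * M) * (wt `^ (1 - r) * qf (Z r) v))).
  have -> : k * (m * M) * (wt `^ (1 - r) * qf (Z r) v) =
    k * ((m * wt `^ (1 - r)) * (M * qf (Z r) v)) by ring.
  rewrite ler_wpM2l //; apply: le_trans (Z_ge v r01) _; rewrite ler_peMl //.
  by rewrite mulr_ge0.
by rewrite ler_wpM2r ?mulr_ge0 ?powR_ge0 // lerDr.
Qed.

(** Up to rescaling each Y_i by w_i, this is the operator concavity of t^r. *)
Lemma power_superadditive r v : 0 <= r <= 1 ->
  \sum_i w i `^ (1 - r) * qf (Y i r) v <= wt `^ (1 - r) * qf (Z r) v.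
Proof.
move=> r01; rewrite -qT.
have [e e0 He] := bounded_some.
have Hk k : bounded (1 + e / 2 ^+ k).
  elim: k => [|k IH]; first by rewrite expr0 divr1.
  have := bounded_sqrt _ IH; rewrite exprSr invfM mulrA; apply.
  by rewrite divr_ge0 // exprn_ge0.
have q0 : 0 <= wt `^ (1 - r) * qf (Z r) v.
  by rewrite mulr_ge0 ?powR_ge0 ?(qf_family_ge0 _ _ Zf).
apply: (@le_halving _ _ (e * (wt `^ (1 - r) * qf (Z r) v))).
  by rewrite mulr_ge0.
move=> k; apply: le_trans (Hk k r v r01) _.
by rewrite mulrDl mul1r mulrAC.
Qed.

End Weighted.

End PowerConcavity.

(** * A noncommutative Minkowski inequality *)

Section TraceSuperadditivity.
Context {R : realType}.
Local Notation C := R[i].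

Lemma tr_spec_mul n (U N : 'M[C]_n) d : U \is unitarymx ->
  complex.Re (\tr (spec U d *m N)) = \sum_k d k * qf N (evec U k).
Proof.
move=> uU; rewrite (tr_evec _ uU); apply: eq_bigr => k _.
have -> : spec U d *m N = (spec U d)^t* *m N by rewrite spec_adj.
by rewrite /qf mulmxA -adjM (spec_evec _ _ uU) adjZ -!scalemxAl mxE ReZ.
Qed.

Lemma tr_sum_spec_mul n m (U : 'I_m -> 'M[C]_n) (N : 'M[C]_n) (d : 'I_m -> 'I_n -> R) :
  (forall j, U j \is unitarymx) ->
  complex.Re (\tr ((\sum_j spec (U j) (d j)) *m N)) =
  \sum_j \sum_k d j k * qf N (evec (U j) k).
Proof.
move=> uU; rewrite mulmx_suml Re_tr_sum; apply: eq_bigr => j _.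
exact: tr_spec_mul.
Qed.

Lemma psd_family n (N : 'M[C]_n) (e : R) : N^t* = N -> 0 < e ->
  (forall v, e * qf 1%:M v <= qf N v) ->
  exists (W : 'M[C]_n) z, [/\ W \is unitarymx, N = spec W z & forall k, e <= z k].
Proof.
move=> Nh e0 Ne; have [W [z [uW NE]]] := herm_spec Nh.
exists W, z; split=> // k.
by have := Ne (evec W k); rewrite (qf1_evec k uW) mulr1 NE (qf_evec _ k uW).
Qed.

Lemma qf_spow_le n (U : 'M[C]_n) (y : 'I_n -> R) r v : U \is unitarymx ->
  (forall k, 0 <= y k) -> 0 <= r <= 1 ->
  qf (spow U y r) v <= (1 + \sum_k y k) * qf 1%:M v.
Proof.
move=> uU y0 r01; rewrite /spow qf_spec -(qf_unitary v uU) qf1E mulr_sumr.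
apply: ler_sum => k _; rewrite ler_wpM2r ?sqm_ge0 //.
apply: le_trans (powR_le_add1 (y0 k) r01) _.
by rewrite lerD2l (bigD1 k) //= lerDl sumr_ge0.
Qed.

Lemma qf_spow_ge n (U : 'M[C]_n) (z : 'I_n -> R) e r v : U \is unitarymx ->
  0 < e -> (forall k, e <= z k) -> 0 <= r <= 1 ->
  qf 1%:M v <= (1 + e^-1) * qf (spow U z r) v.
Proof.
move=> uU e0 ez r01; rewrite /spow qf_spec -(qf_unitary v uU) qf1E mulr_sumr.
have ei : 0 < e^-1 by rewrite invr_gt0.
have m0 : 0 < 1 + e^-1 by rewrite addr_gt0.
apply: ler_sum => k _; rewrite mulrA ler_peMl ?sqm_ge0 // -ler_pdivrMl // mulr1.
have z0 : 0 < z k by exact: lt_le_trans (ez k).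
apply: powR_inv_le => //; first by rewrite lerDl ltW.
apply: (@le_trans _ _ e^-1); last by rewrite lerDr.
by rewrite lef_pV2 ?posrE.
Qed.

Lemma le_eps (a b c : R) : (forall e, 0 < e -> a <= b + c * e) -> a <= b.
Proof.
move=> H; have [c0|c0] := leP c 0.
  by have := H 1 ltr01; lra.
rewrite leNgt; apply/negP => ba.
have e0 : 0 < (a - b) / (2 * c) by rewrite divr_gt0; lra.
have := H _ e0.
have -> : c * ((a - b) / (2 * c)) = (a - b) / 2 by field; rewrite gt_eqF.
lra.
Qed.

Lemma young_absorb (p a b c e : R) :
  p * a <= b + (p - 1) * (a + c * e) -> a <= b + (p - 1) * c * e.
Proof. by lra. Qed.

(** With T_i the i-th summand on the left, T' the matrix on the right,
    r = 1 - 1/p, Y_i = T_i^p + e and Z = sum_i Y_i, one has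
    sum_i Tr T_i^p <= sum_i Tr (T_i Y_i^r) <= Tr (T' Z^r), the second step by
    superadditivity at each eigenvector of each summand.  Young's inequality
    bounds p Tr (T' Z^r) by Tr T'^p + (p - 1) Tr Z, and Tr Z is the left side plus
    O(e).  The shift by e makes the Y_i invertible. *)
Lemma trp_superadditive n m l p (U : 'I_m -> 'M[C]_n)
    (w : 'I_l -> 'I_m -> 'I_n -> R) :
  1 <= p -> (forall j, U j \is unitarymx) -> (forall i j k, 0 <= w i j k) ->
  \sum_i trp p (\sum_j spec (U j) (fun k => w i j k `^ p^-1)) <=
  trp p (\sum_j spec (U j) (fun k => (\sum_i w i j k) `^ p^-1)).
Proof.
move=> p1 uU w0.
case: l w w0 => [|l] w w0; first by rewrite big_ord0 trp_ge0.
have p0 : 0 < p by lra.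
have pn0 : p != 0 by rewrite gt_eqF.
pose r := 1 - p^-1.
have rE : 1 - r = p^-1 by rewrite /r opprB addrC subrK.
have pr : p * r = p - 1 by rewrite /r mulrBr mulr1 divff.
have r01 : 0 <= r <= 1.
  rewrite /r subr_ge0 lerBlDr lerDl invr_ge0 (ltW p0) andbT.
  by rewrite invf_le1.
pose T i := \sum_j spec (U j) (fun k => w i j k `^ p^-1).
pose T' := \sum_j spec (U j) (fun k => (\sum_i w i j k) `^ p^-1).
rewrite -/T'.
have psd_sum (d : 'I_m -> 'I_n -> R) : (forall j k, 0 <= d j k) ->
    exists V t, [/\ V \is unitarymx, \sum_j spec (U j) (d j) = spec V t & forall k, 0 <= t k].
  move=> d0; apply: psd_spec => [|v].
    by rewrite adj_sum; apply: eq_bigr => j _; exact: spec_adj.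
  rewrite qf_sum sumr_ge0 // => j _; rewrite qf_spec sumr_ge0 // => k _.
  by rewrite mulr_ge0 ?sqm_ge0.
have T'psd : exists V t, [/\ V \is unitarymx, T' = spec V t & forall k, 0 <= t k].
  by apply: psd_sum => j k; exact: powR_ge0.
have /fin_all_exists[Vt HVt] : forall i, exists Vt : 'M[C]_n * ('I_n -> R),
    [/\ Vt.1 \is unitarymx, T i = spec Vt.1 Vt.2 & forall k, 0 <= Vt.2 k].
  move=> i; have [|V [t [uV TE t0]]] := psd_sum (fun j k => w i j k `^ p^-1).
    by move=> j k; exact: powR_ge0.
  by exists (V, t).
pose V i := (Vt i).1; pose t i := (Vt i).2.
have uV i : V i \is unitarymx by have [] := HVt i.
have TE i : T i = spec (V i) (t i) by have [] := HVt i.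
have t0 i k : 0 <= t i k by have [_ _] := HVt i; exact.
have trT i : trp p (T i) = \sum_k t i k `^ p.
  by rewrite TE trp_spec.
rewrite -/(T _); have {psd_sum} [V' [t' [uV' T'E t'0]]] := T'psd.
apply: (@le_eps _ _ ((p - 1) * (l.+1%:R * n%:R))) => e e0.
pose y i k := t i k `^ p + e.
have y0 i k : 0 < y i k by rewrite ltr_wpDl ?powR_ge0.
have y0' i k : 0 <= y i k by exact: ltW.
have [N NE] : exists N, N = \sum_i spec (V i) (y i) by eexists.
have Nh : N^t* = N.
  by rewrite NE adj_sum; apply: eq_bigr => i _; exact: spec_adj.
have Ne v : e * qf 1%:M v <= qf N v.
  rewrite NE qf_sum (bigD1 ord0) //=.
  apply: (@le_trans _ _ (qf (spec (V ord0) (y ord0)) v)).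
    rewrite qf_spec -(qf_unitary v (uV ord0)) qf1E mulr_sumr.
    by apply: ler_sum => k _; rewrite ler_wpM2r ?sqm_ge0 // lerDr powR_ge0.
  rewrite lerDl sumr_ge0 // => i _; rewrite qf_spec sumr_ge0 // => k _.
  by rewrite mulr_ge0 ?sqm_ge0.
have [W [z [uW NW ez]]] := psd_family Nh e0 Ne.
have z0 k : 0 < z k by exact: lt_le_trans (ez k).
pose Y i := spow (V i) (y i); pose Z := spow W z.
have Yf i : power_family (Y i) := spow_family (uV i) (y0 i).
have Zf : power_family Z := spow_family uW z0.
have ZE : \sum_i Y i 1 = Z 1.
  rewrite /Z spow1 => [|k]; last exact: ltW.
  by rewrite -NW NE; apply: eq_bigr => i _; exact: spow1.
have yy0 i : 0 <= \sum_k y i k by rewrite sumr_ge0.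
have super j k : \sum_i w i j k `^ p^-1 * qf (Y i r) (evec (U j) k) <=
    (\sum_i w i j k) `^ p^-1 * qf (Z r) (evec (U j) k).
  have [/eqP w00|wn0] := eqVneq (\sum_i w i j k) 0.
    move: (w00); rewrite psumr_eq0 // => /allP wz.
    rewrite big1 => [|i _]; first by rewrite mulr_ge0 ?powR_ge0 ?(qf_family_ge0 _ _ Zf).
    have /eqP -> := wz i (mem_index_enum i).
    by rewrite powR0 ?invr_eq0 // mul0r.
  rewrite -rE; apply: (@power_superadditive _ _ _ Y (fun i => w i j k) Z
    (1 + e^-1) (1 + \sum_i \sum_k y i k)) => //.
  - by rewrite lt_def wn0 sumr_ge0.
  - by rewrite addr_ge0 // sumr_ge0.
  - by rewrite addr_ge0 // invr_ge0 ltW.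
  - move=> i s v s01; apply: le_trans (qf_spow_le v (uV i) (y0' i) s01) _.
    rewrite ler_wpM2r ?qf1_ge0 // lerD2l (bigD1 i) //= lerDl sumr_ge0 //.
  - by move=> s v s01; exact: qf_spow_ge.
have lower i : trp p (T i) <= complex.Re (\tr (T i *m Y i r)).
  rewrite trT TE /Y /spow (specM _ _ (uV i)) (tr_spec _ (uV i)).
  apply: ler_sum => k _; rewrite -(mulr_powRB1 (t0 i k) p0) ler_wpM2l //.
  rewrite -pr powRrM; have /andP[r0 _] := r01.
  by apply: ge0_ler_powR; rewrite ?nnegrE ?powR_ge0 // lerDl ltW.
have trTY i : complex.Re (\tr (T i *m Y i r)) =
    \sum_j \sum_k w i j k `^ p^-1 * qf (Y i r) (evec (U j) k).
  exact: tr_sum_spec_mul.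
have trTZ : complex.Re (\tr (T' *m Z r)) =
    \sum_j \sum_k (\sum_i w i j k) `^ p^-1 * qf (Z r) (evec (U j) k).
  exact: tr_sum_spec_mul.
have sumN : \sum_k z k = \sum_i trp p (T i) + l.+1%:R * n%:R * e.
  rewrite -(tr_spec z uW) -NW NE Re_tr_sum.
  under eq_bigr => i _ do rewrite (tr_spec _ (uV i)) /y big_split /= -trT.
  rewrite big_split /= !sumr_const !card_ord; congr (_ + _).
  by rewrite -[LHS]mulr_natl -[X in _ * X]mulr_natl mulrA.
have upper : p * complex.Re (\tr (T' *m Z r)) <= trp p T' + (p - 1) * \sum_k z k.
  rewrite mxtrace_mulC (tr_spec_mul _ _ uW) !mulr_sumr.
  have T'0 k : 0 <= qf T' (evec W k).
    by rewrite T'E qf_spec sumr_ge0 // => j _; rewrite mulr_ge0 ?sqm_ge0.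
  apply: (@le_trans _ _ (\sum_k ((qf T' (evec W k)) `^ p + (p - 1) * z k))).
    apply: ler_sum => k _.
    have := powR_tangent p1 (T'0 k) (powR_ge0 (z k) p^-1).
    rewrite -!powRrM mulVf // powRr1 ?(ltW (z0 k)) //.
    by rewrite mulrBr mulr1 mulVf.
  rewrite big_split /= lerD2r; apply: le_trans (diag_le_trp T' uW p1).
  by apply: ler_sum => k _; rewrite ger0_norm.
have chain : \sum_i trp p (T i) <= complex.Re (\tr (T' *m Z r)).
  apply: le_trans (ler_sum _ (fun i _ => lower i)) _.
  under eq_bigr => i _ do rewrite trTY.
  rewrite trTZ exchange_big; apply: ler_sum => j _ /=.
  by rewrite exchange_big; apply: ler_sum => k _ /=; exact: super.
apply: young_absorb; rewrite -sumN.
exact: le_trans (ler_wpM2l (ltW p0) chain) upper.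
Qed.

End TraceSuperadditivity.

(** * Concave functions *)

Section Concave.
Context {R : realType}.

Section ConcaveFunction.
Variables (f : R -> R).
Hypothesis fc : concave_nneg f.

Let f0 x : 0 <= x -> 0 <= f x. Proof. by case: fc => + _; exact. Qed.

Lemma concave_ineq (t x y : R) : 0 <= t <= 1 -> 0 <= x -> 0 <= y ->
  t * f x + (1 - t) * f y <= f (t * x + (1 - t) * y).
Proof.
move=> /andP[t0 t1] x0 y0; case: fc => _ /(_ (Itv01 t0 t1) x y).
rewrite !inE /= !in_itv /= !andbT => /(_ x0 y0).
rewrite convRE => H.
have {}H : - f (t * x + (1 - t) * y) <= t * - f x + (1 - t) * - f y by exact: H.
by clear -H; lra.
Qed.

Lemma concave_slopes (x y z : R) : 0 <= x -> x < y -> y < z ->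
  (f z - f y) * (y - x) <= (f y - f x) * (z - y).
Proof.
move=> x0 xy yz; have zx : 0 < z - x by lra.
pose t := (z - y) / (z - x).
have t01 : 0 <= t <= 1.
  have zy : 0 <= z - y by lra.
  by rewrite /t (divr_ge0 zy (ltW zx)) /= ler_pdivrMr // mul1r; lra.
have z0 : 0 <= z by lra.
have := concave_ineq t01 x0 z0.
have -> : t * x + (1 - t) * z = y by rewrite /t; field; rewrite gt_eqF.
have -> : t * f x + (1 - t) * f z = ((z - y) * f x + (y - x) * f z) / (z - x).
  by rewrite /t; field; rewrite gt_eqF.
by rewrite ler_pdivrMr //; clear; lra.
Qed.

(** A decrease from x to y would, by concavity, make f negative further right; z
    is where the extended chord takes the value -1. *)
Lemma concave_nondecreasing (x y : R) : 0 <= x -> x <= y -> f x <= f y.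
Proof.
move=> x0; rewrite le_eqVlt => /predU1P[->//|xy]; rewrite leNgt; apply/negP => fyx.
have y0 : 0 <= y by lra.
have fy0 := f0 y0.
have d0 : 0 < f x - f y by rewrite subr_gt0.
pose z := y + (f y + 1) * (y - x) / (f x - f y).
have yz : y < z by rewrite ltrDl divr_gt0 // mulr_gt0 ?subr_gt0 //; lra.
have := concave_slopes x0 xy yz.
have fz0 : 0 <= f z by apply: f0; lra.
have -> : (f y - f x) * (z - y) = - (f y + 1) * (y - x).
  by rewrite /z; field; rewrite gt_eqF.
have : 0 < (f z + 1) * (y - x) by rewrite mulr_gt0 ?subr_gt0 //; lra.
lra.
Qed.

Lemma concave_ratio (x y : R) : 0 <= x -> x <= y -> x * f y <= y * f x.
Proof.
move=> x0 xy; have [y0|y0] := leP y 0.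
  by have -> : x = 0 by [lra]; rewrite (_ : y = 0) ?mul0r //; lra.
have t01 : 0 <= x / y <= 1.
  by rewrite divr_ge0 ?(ltW y0) //= ler_pdivrMr // mul1r.
have := concave_ineq t01 (ltW y0) (lexx 0).
rewrite mulr0 addr0 divfK ?gt_eqF // => H.
have h0 : 0 <= (1 - x / y) * f 0 by rewrite mulr_ge0 ?f0 // subr_ge0; lra.
have : x / y * f y <= f x by lra.
by rewrite mulrAC ler_pdivrMr // mulrC [f x * _]mulrC.
Qed.

(** Concavity of u |-> f(u^(1/p))^p, in terms of slopes.  The chord a + b t of f
    through y and z lies above f at x and has a, b >= 0, so f may be replaced by
    it.  As y (a + b t) = f(y) (k y + (1 - k) t) with k = a / f(y), convexity of
    the p-th power bounds (a + b t)^p by an affine function of t^p that is exact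
    at t = y. *)
Lemma power_slopes (p x y z : R) : 1 <= p -> 0 <= x -> x < y -> y < z ->
  (f z `^ p - f y `^ p) * (y `^ p - x `^ p) <=
  (f y `^ p - f x `^ p) * (z `^ p - y `^ p).
Proof.
move=> p1 x0 xy yz.
have y0 : 0 < y by lra. have z0 : 0 < z by lra.
have p0 : 0 < p by lra.
pose b := (f z - f y) / (z - y); pose a := f y - b * y.
have zy : 0 < z - y by lra.
have b0 : 0 <= b.
  by rewrite divr_ge0 ?(ltW zy) // subr_ge0 concave_nondecreasing // ltW.
have a0 : 0 <= a.
  rewrite -(pmulr_lge0 _ zy).
  have -> : a * (z - y) = z * f y - y * f z.
    by rewrite /a /b; field; rewrite gt_eqF.
  by rewrite subr_ge0 concave_ratio // ltW.
have fyE : f y = a + b * y by rewrite /a subrK.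
have fzE : f z = a + b * z by rewrite /a /b; field; rewrite gt_eqF.
have fxE : f x <= a + b * x.
  have := concave_slopes x0 xy yz.
  have -> : f z - f y = b * (z - y) by rewrite fzE fyE; ring.
  rewrite mulrAC ler_pM2r // fyE; lra.
have lx0 : 0 <= a + b * x by rewrite addr_ge0 // mulr_ge0.
have h1 : f x `^ p <= (a + b * x) `^ p.
  by apply: ge0_ler_powR; rewrite ?nnegrE ?(ltW p0) // f0.
have pmono s t : 0 <= s -> s <= t -> s `^ p <= t `^ p.
  by move=> s0 st; apply: ge0_ler_powR; rewrite ?nnegrE ?(ltW p0) // (le_trans s0).
have yx' : 0 <= y `^ p - x `^ p by rewrite subr_ge0 pmono // ltW.
have zy' : 0 <= z `^ p - y `^ p by rewrite subr_ge0 pmono // ltW.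
have yp0 : 0 < y `^ p by rewrite powR_gt0.
have [M0|Mn0] := eqVneq (f y) 0.
  have by0 : b * y = 0.
    by apply/eqP; rewrite eq_le mulr_ge0 ?(ltW y0) // andbT; lra.
  have bz : b = 0 by move/eqP: by0; rewrite mulf_eq0 (gt_eqF y0) orbF => /eqP.
  have fz0 : f z = 0 by rewrite fzE bz mul0r; lra.
  have fx0 : f x = 0.
    by apply/eqP; rewrite eq_le f0 // andbT; apply: le_trans fxE _; rewrite bz; lra.
  by rewrite M0 fz0 fx0 !subrr !mul0r.
have M0 : 0 < f y by rewrite lt_def Mn0 f0 // ltW.
pose k := a / f y.
have k0 : 0 <= k by rewrite divr_ge0 // ltW.
have k1 : k <= 1.
  by rewrite ler_pdivrMr // mul1r fyE lerDl mulr_ge0 // ltW.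
have line t : 0 <= t -> y `^ p * (a + b * t) `^ p <=
    f y `^ p * (y `^ p + (1 - k) * (t `^ p - y `^ p)).
  move=> t0; have lt0 : 0 <= a + b * t by rewrite addr_ge0 // mulr_ge0.
  rewrite -powRM // ?(ltW y0) //.
  have -> : y * (a + b * t) = f y * (k * y + (1 - k) * t).
    have fk : f y * k = a by rewrite mulrC divfK.
    have -> : f y * (k * y + (1 - k) * t) = f y * k * y + (f y - f y * k) * t.
      by ring.
    by rewrite fk fyE; ring.
  have kt : 0 <= k * y + (1 - k) * t by rewrite addr_ge0 // mulr_ge0 ?(ltW y0) ?subr_ge0.
  rewrite powRM ?(ltW M0) // ler_wpM2l ?powR_ge0 //.
  have k01 : 0 <= k <= 1 by rewrite k0.
  apply: le_trans (powR_convex2 p1 k01 (ltW y0) t0) _.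
  by rewrite le_eqVlt; apply/orP; left; apply/eqP; ring.
have lz := line z (ltW z0); have lx := line x x0; rewrite -fzE in lz.
have {}lx : y `^ p * f x `^ p <= f y `^ p * (y `^ p + (1 - k) * (x `^ p - y `^ p)).
  by apply: le_trans lx; rewrite ler_wpM2l ?powR_ge0.
move: yx' zy' yp0 lz lx.
move: (x `^ p) (y `^ p) (z `^ p) (f x `^ p) (f y `^ p) (f z `^ p) => X Y Z FX FY FZ.
move=> YX ZY Y0 lz lx.
have {}lz : Y * (FZ - FY) <= FY * (1 - k) * (Z - Y) by clear -lz; lra.
have {}lx : FY * (1 - k) * (Y - X) <= Y * (FY - FX) by clear -lx; lra.
rewrite -(ler_pM2l Y0) !mulrA.
apply: le_trans (ler_wpM2r YX lz) _.
by rewrite mulrAC ler_wpM2r.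
Qed.

End ConcaveFunction.

(** Abel summation.  Between consecutive points v k of the sorted list 0 :: s, let
    d k be the slope of h relative to g, and 0 after the last point; the
    coefficients are the decrements d i - d (i + 1), which the slope condition
    makes nonnegative. *)
Lemma concave_decomposition (h g : R -> R) (s : seq R) :
  g 0 = 0 ->
  (forall x y, 0 <= x -> x < y -> g x < g y) ->
  (forall x y, 0 <= x -> x <= y -> h x <= h y) ->
  (forall x y z, 0 <= x -> x < y -> y < z ->
     (h z - h y) * (g y - g x) <= (h y - h x) * (g z - g y)) ->
  all (>= 0) s ->
  exists N (c u : 'I_N -> R),
    [/\ forall i, 0 <= c i, forall i, 0 < u i &
        forall x, x \in s -> h x = h 0 + \sum_i c i * g (Num.min x (u i))].
Proof.
move=> g0 gm hm slopes s0.
pose l := sort <=%R (undup (0 :: s)).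
have ll : sorted <%R l by rewrite sort_lt_sorted undup_uniq.
have meml x : (x \in l) = (x \in 0 :: s) by rewrite mem_sort mem_undup.
have l0 : all (>= 0) l.
  by apply/allP => x; rewrite meml inE => /predU1P[->//|]; exact: (allP s0).
have sl : (0 < size l)%N.
  have : 0 \in l by rewrite meml in_cons eqxx.
  by case: (l).
pose N := (size l).-1; pose v i := nth 0 l i.
have szl : size l = N.+1 by rewrite /N prednK.
have v_lt i j : (i < j)%N -> (j <= N)%N -> v i < v j.
  move=> ij jN; apply: (sorted_ltn_nth lt_trans) => //; rewrite inE szl ltnS //.
  exact: leq_trans (ltnW ij) jN.
have v_le i j : (i <= j)%N -> (j <= N)%N -> v i <= v j.
  by rewrite leq_eqVlt => /predU1P[->//|ij] jN; apply: ltW; exact: v_lt.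
have v00 i : (i <= N)%N -> 0 <= v i.
  by move=> iN; apply: (allP l0); rewrite mem_nth // szl ltnS.
have v0 : v 0%N = 0.
  have : 0 \in l by rewrite meml in_cons eqxx.
  move/(nthP 0) => [k kl vk]; apply/eqP; rewrite eq_le v00 // andbT.
  by rewrite -vk; apply: v_le => //; rewrite -ltnS -szl.
pose d k := if (k < N)%N then (h (v k.+1) - h (v k)) / (g (v k.+1) - g (v k)) else 0.
have gd k : (k < N)%N -> 0 < g (v k.+1) - g (v k).
  by move=> kN; rewrite subr_gt0 gm // ?v00 ?v_lt // ltnW.
have d_dec k : d k.+1 <= d k.
  rewrite /d; case: ltnP => kN.
    rewrite (ltnW kN) ler_pdivrMr ?gd // mulrAC ler_pdivlMr ?gd //; last exact: ltnW.
    apply: slopes; [|by apply: v_lt => //; exact: ltnW|exact: v_lt].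
    by apply: v00; exact: ltnW (ltnW kN).
  case: ltnP => // kN'; apply: divr_ge0; last exact: ltW (gd _ kN').
  by rewrite subr_ge0; apply: hm; [apply: v00; exact: ltnW|exact: v_le].
exists N, (fun i : 'I_N => d i - d i.+1), (fun i : 'I_N => v i.+1); split.
- by move=> i; rewrite subr_ge0.
- by move=> i; rewrite -v0; apply: v_lt.
move=> x xs; have : x \in l by rewrite meml inE xs orbT.
move/(nthP 0) => [k]; rewrite szl ltnS => kN <-{x xs}; rewrite -/(v k).
elim: k kN => [|k IH] kN.
  rewrite big1 ?addr0 ?v0 // => i _; rewrite min_l ?g0 ?mulr0 //.
  by rewrite v00.
have -> : h (v k.+1) = h (v k) + d k * (g (v k.+1) - g (v k)).
  by rewrite /d kN divfK ?subrKC // gt_eqF // gd.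
rewrite IH ?(ltnW kN) // -addrA; congr (_ + _).
have -> : d k = \sum_(i < N | (k <= i)%N) (d i - d i.+1).
  rewrite -(big_mkord (fun i => (k <= i)%N) (fun i => d i - d i.+1)).
  rewrite (big_cat_nat (n := k)) ?(ltnW kN) //=.
  rewrite big_nat_cond big1 ?add0r => [|i /andP[/andP[_ ik]]]; last by rewrite leqNgt ik.
  have tele : \sum_(k <= i < N) (d i - d i.+1) = d k.
    rewrite -[RHS]opprK -[LHS]opprK -sumrN; congr (- _).
    under eq_bigr do rewrite opprB.
    by rewrite telescope_sumr ?(ltnW kN) // /d ltnn sub0r.
  rewrite -[LHS]tele [LHS]big_nat_cond [RHS]big_nat_cond; apply: eq_bigl => i.
  by case: (k <= i)%N; case: (i < N)%N.
rewrite mulr_suml [X in _ + X]big_mkcond -big_split /=; apply: eq_bigr => i _.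
case: leqP => ik.
  rewrite !min_l; last 2 first.
  - by apply: v_le.
  - by apply: v_le => //; exact: leqW.
  ring.
rewrite addr0 !min_r //; apply: v_le => //; last exact: ltnW.
exact: leqW.
Qed.

End Concave.

(** * Finite exponents *)

Section FiniteExponent.
Context {R : realType}.
Local Notation C := R[i].

Lemma trp_scale n (p a : R) (M : 'M[C]_n) : M^t* = M -> (forall v, 0 <= qf M v) ->
  0 <= a -> trp p (a%:C *: M) = a `^ p * trp p M.
Proof.
move=> Mh M0 a0; have [U [d [uU -> d0]]] := psd_spec Mh M0.
have ad0 k : 0 <= a * d k by rewrite mulr_ge0.
rewrite specZ (trp_spec p uU ad0) (trp_spec p uU d0) mulr_sumr.
by apply: eq_bigr => k _; rewrite powRM.
Qed.

(** The index [ord0] of w carries the constant term f(0)^p, the others the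
    truncations.  The constant term is handled by kappa >= 1 and m >= 1. *)
Lemma concave_bound n m (p kappa : R) (f : R -> R) (A : 'I_m -> 'M[C]_n) :
  (0 < m)%N -> 1 <= p -> 1 <= kappa -> concave_nneg f ->
  (forall B : 'I_m -> 'M[C]_n,
     trp p (\sum_j B j) <= kappa * trp p (\sum_j mxabs (B j))) ->
  trp p (funcalc f (mxabs (\sum_j A j))) <=
  kappa * trp p (\sum_j funcalc f (mxabs (A j))).
Proof.
move=> m0 p1 k1 fc lin.
have p0 : 0 < p by lra.
have pn0 : p != 0 by rewrite gt_eqF.
have pi : p^-1 * p = 1 by rewrite mulVf.
have kge0 : 0 <= kappa by lra.
have f0 x : 0 <= x -> 0 <= f x by case: fc => + _; exact.
have [V [sg [uV aS _ _ sg0]]] := funcalc_mxabs f (\sum_j A j).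
have /fin_all_exists[Ud HU] : forall j, exists Ud : 'M[C]_n * ('I_n -> R),
    [/\ Ud.1 \is unitarymx, mxabs (A j) = spec Ud.1 Ud.2 & forall k, 0 <= Ud.2 k].
  by move=> j; have [U [d [uU aA _ d0]]] := mxabs_spec (A j); exists (U, d).
pose U j := (Ud j).1; pose d j := (Ud j).2.
have uU j : U j \is unitarymx by have [] := HU j.
have aA j : mxabs (A j) = spec (U j) (d j) by have [] := HU j.
have d0 j k : 0 <= d j k by have [_ _] := HU j; exact.
have FA g j : funcalc g (mxabs (A j)) = spec (U j) (g \o d j).
  by rewrite aA; exact: (funcalc_spec (d j) g (uU j)).
have FS g : funcalc g (mxabs (\sum_j A j)) = spec V (g \o sg).
  by rewrite aS; exact: (funcalc_spec sg g uV).
have fp_slopes x y z : 0 <= x -> x < y -> y < z ->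
   (f z `^ p - f y `^ p) * (y `^ p - x `^ p) <=
   (f y `^ p - f x `^ p) * (z `^ p - y `^ p).
  exact: power_slopes.
have gm (x y : R) : 0 <= x -> x < y -> x `^ p < y `^ p.
  move=> x0 xy; apply: gt0_ltr_powR; rewrite ?nnegrE //.
  exact: le_trans x0 (ltW xy).
have hm (x y : R) : 0 <= x -> x <= y -> f x `^ p <= f y `^ p.
  move=> x0 xy; have y0 := le_trans x0 xy.
  apply: ge0_ler_powR; rewrite ?nnegrE ?(ltW p0) ?f0 //.
  exact: concave_nondecreasing.
pose pts := codom sg ++ [seq d jk.1 jk.2 | jk : 'I_m * 'I_n].
have pts0 : all (>= 0) pts.
  by apply/allP => x; rewrite mem_cat => /orP[] /codomP[k ->].
have [N [c [u [c0 u0 rep]]]] :=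
  concave_decomposition (powR0 pn0) gm hm fp_slopes pts0.
have rep_sg k : f (sg k) `^ p = f 0 `^ p + \sum_i c i * cut (u i) (sg k) `^ p.
  by apply: rep; rewrite mem_cat codom_f.
have rep_d j k : f (d j k) `^ p = f 0 `^ p + \sum_i c i * cut (u i) (d j k) `^ p.
  apply: rep; rewrite mem_cat; apply/orP; right; apply/codomP.
  by exists (j, k).
have cut0 i x : 0 <= x -> 0 <= cut (u i) x.
  by move=> x0; rewrite /cut le_min x0 ltW.
pose w (i : 'I_N.+1) j k := if unlift ord0 i is Some i'
  then c i' * cut (u i') (d j k) `^ p else f 0 `^ p.
have w0 i j k : 0 <= w i j k.
  by rewrite /w; case: unlift => [i'|]; rewrite ?mulr_ge0 ?powR_ge0.
have sum_w j k : \sum_i w i j k = f (d j k) `^ p.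
  rewrite rep_d big_ord_recl /w unlift_none; congr (_ + _).
  by apply: eq_bigr => i _; rewrite liftK.
have super := trp_superadditive p1 uU w0.
have RHS_E : \sum_j funcalc f (mxabs (A j)) =
    \sum_j spec (U j) (fun k => (\sum_i w i j k) `^ p^-1).
  apply: eq_bigr => j _; rewrite FA; apply: eq_spec => k /=.
  by rewrite sum_w -powRrM mulfV // powRr1 // f0.
rewrite {}RHS_E; apply: le_trans (ler_wpM2l kge0 super).
rewrite big_ord_recl mulrDr mulr_sumr.
have fsg0 k : 0 <= (f \o sg) k by exact: f0.
rewrite FS (trp_spec p uV fsg0).
have -> : \sum_k (f \o sg) k `^ p =
    n%:R * f 0 `^ p + \sum_i c i * trp p (funcalc (cut (u i)) (mxabs (\sum_j A j))).
  under eq_bigr => k _ do rewrite /= rep_sg.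
  rewrite big_split /= sumr_const card_ord -[f 0 `^ p *+ n]mulr_natl; congr (_ + _).
  rewrite exchange_big; apply: eq_bigr => i _ /=.
  have csg0 k : 0 <= (cut (u i) \o sg) k by exact: cut0.
  by rewrite FS (trp_spec p uV csg0) mulr_sumr.
apply: lerD.
  pose j0 := Ordinal m0.
  have a0 : 0 <= (f 0 `^ p) `^ p^-1 by exact: powR_ge0.
  have w0E j : spec (U j) (fun k => w ord0 j k `^ p^-1) =
               spec (U j) (fun=> (f 0 `^ p) `^ p^-1).
    by apply: eq_spec => k; rewrite /w unlift_none.
  under eq_bigr => j _ do rewrite w0E.
  have trc : trp p (spec (U j0) (fun=> (f 0 `^ p) `^ p^-1)) = n%:R * f 0 `^ p.
    rewrite (trp_spec p (uU j0)) // sumr_const card_ord -[LHS]mulr_natl.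
    by rewrite -powRrM pi powRr1 ?powR_ge0.
  have qc j v : 0 <= qf (spec (U j) (fun=> (f 0 `^ p) `^ p^-1)) v.
    by rewrite qf_spec sumr_ge0 // => k _; rewrite mulr_ge0 ?sqm_ge0.
  rewrite -trc.
  have mono := @trp_mono R n (spec (U j0) (fun=> (f 0 `^ p) `^ p^-1))
    (\sum_j spec (U j) (fun=> (f 0 `^ p) `^ p^-1)) p p1 (spec_adj _ _) (qc j0).
  apply: le_trans (mono _) _ => [v|].
    by rewrite qf_sum (bigD1 j0) //= lerDl sumr_ge0.
  by rewrite ler_peMl ?trp_ge0.
apply: ler_sum => i _.
have wiE j : spec (U j) (fun k => w (lift ord0 i) j k `^ p^-1) =
             (c i `^ p^-1)%:C *: funcalc (cut (u i)) (mxabs (A j)).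
  rewrite FA specZ; apply: eq_spec => k; rewrite /w liftK /=.
  by rewrite powRM ?powR_ge0 // -powRrM mulfV // powRr1 // cut0.
rewrite [X in _ <= _ * trp p X](eq_bigr _ (fun j _ => wiE j)).
rewrite -scaler_sumr trp_scale ?powR_ge0 //; last 2 first.
- by rewrite adj_sum; apply: eq_bigr => j _; exact: funcalc_adj.
- move=> v; rewrite qf_sum sumr_ge0 // => j _; apply: qf_funcalc_ge0.
  exact: cut0.
rewrite -powRrM pi powRr1 // mulrCA ler_wpM2l //.
exact: cut_bound.
Qed.

End FiniteExponent.

(** * The operator norm *)

Section OperatorNorm.
Context {R : realType}.
Local Notation C := R[i].

Lemma l2normE n (x : 'cV[C]_n) : l2norm x = Num.sqrt (qf 1%:M x).
Proof. by rewrite /l2norm /qf mulmx1. Qed.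

Lemma l2norm_le1 n (x : 'cV[C]_n) : (l2norm x <= 1) = (qf 1%:M x <= 1).
Proof.
by rewrite l2normE -[X in Num.sqrt _ <= X]sqrtr1 ler_psqrt // ?nnegrE ?qf1_ge0.
Qed.

Lemma l2norm_bound n (A : 'M[C]_n) (s : R) x : 0 <= s ->
  (forall v, qf 1%:M (A *m v) <= s ^+ 2 * qf 1%:M v) ->
  l2norm x <= 1 -> l2norm (A *m x) <= s.
Proof.
move=> s0 As; rewrite l2norm_le1 => x1.
rewrite l2normE -[s]ger0_norm // -sqrtr_sqr ler_psqrt ?nnegrE ?qf1_ge0 ?sqr_ge0 //.
by apply: le_trans (As x) _; rewrite ler_piMr // sqr_ge0.
Qed.

Lemma opnorm_le n (A : 'M[C]_n) (s : R) : 0 <= s ->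
  (forall v, qf 1%:M (A *m v) <= s ^+ 2 * qf 1%:M v) -> opnorm A <= s.
Proof.
move=> s0 As; apply: ge_sup.
  exists (l2norm (A *m 0)), 0 => //=.
  by rewrite l2norm_le1 qf1E big1 // => k _; rewrite mxE sqmE /= expr0n addr0.
by move=> _ [x /= x1 <-]; exact: l2norm_bound.
Qed.

Lemma mxabs_top n (A : 'M[C]_n) : (0 < n)%N -> exists U s k,
  [/\ U \is unitarymx, mxabs A = spec U s, A^t* *m A = spec U (fun k => s k ^+ 2),
      forall k, 0 <= s k & forall l, s l <= s k].
Proof.
move=> n0; have [U [s [uU aA AA s0]]] := mxabs_spec A.
pose k := [arg max_(i > Ordinal n0) s i]%O.
exists U, s, k; split => // l; rewrite /k; case: arg_maxP => // i _; exact.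
Qed.

Lemma opnorm_ge n (A : 'M[C]_n) x : qf 1%:M x <= 1 ->
  Num.sqrt (qf 1%:M (A *m x)) <= opnorm A.
Proof.
move=> x1; have [U [s [uU _ AA s0]]] := mxabs_spec A.
pose t := \sum_k s k.
have t0 : 0 <= t by rewrite sumr_ge0.
have At v : qf 1%:M (A *m v) <= t ^+ 2 * qf 1%:M v.
  rewrite -qf_gram AA qf_spec -(qf_unitary v uU) qf1E mulr_sumr.
  apply: ler_sum => k _; rewrite ler_wpM2r ?sqm_ge0 //.
  rewrite ler_pXn2r ?nnegrE // /t (bigD1 k) //= lerDl sumr_ge0 //.
rewrite -l2normE; apply: ub_le_sup.
  by exists t => _ [y /= y1 <-]; exact: l2norm_bound.
by exists x => //=; rewrite l2norm_le1.
Qed.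

Lemma opnorm_ge0 n (A : 'M[C]_n) : 0 <= opnorm A.
Proof.
apply: le_trans (opnorm_ge A (x := 0) _); first exact: sqrtr_ge0.
by rewrite qf1E big1 // => k _; rewrite mxE sqmE /= expr0n addr0.
Qed.

Lemma qf_le_opnorm n (A : 'M[C]_n) u : qf 1%:M u = 1 -> qf A u <= opnorm A.
Proof.
move=> u1; apply: le_trans (opnorm_ge A (x := u) _); last by rewrite u1.
apply: le_trans (ler_norm _) _; rewrite -sqrtr_sqr ler_psqrt ?nnegrE ?sqr_ge0 ?qf1_ge0 //.
have := le_trans (sqm_Re _) (cauchy_schwarz u (A *m u)).
by rewrite u1 mul1r mulmxA.
Qed.

Lemma opnorm_spec_le n (U : 'M[C]_n) d (s : R) : U \is unitarymx ->
  (forall k, 0 <= d k) -> (forall k, d k <= s) -> 0 <= s -> opnorm (spec U d) <= s.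
Proof.
move=> uU d0 ds s0; apply: opnorm_le => // v.
rewrite -qf_gram spec_adj (specM _ _ uU) qf_spec -(qf_unitary v uU) qf1E mulr_sumr.
apply: ler_sum => k _; rewrite ler_wpM2r ?sqm_ge0 // expr2.
by apply: ler_pM.
Qed.

Lemma opnorm_mxabs n (A : 'M[C]_n) : opnorm (mxabs A) = opnorm A.
Proof.
have E : (fun x => l2norm (mxabs A *m x)) = (fun x => l2norm (A *m x)).
  by apply/funext => x; rewrite !l2normE abs_isometry.
exact: (congr1 (fun g => sup [set g x | x in [set x | l2norm x <= 1]]) E).
Qed.

Lemma concave_bound_inf n m (c : R) (f : R -> R) (A : 'I_m -> 'M[C]_n) :
  (0 < n)%N -> (0 < m)%N -> 1 <= c -> concave_nneg f ->
  (forall B : 'I_m -> 'M[C]_n,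
     opnorm (\sum_j B j) <= c * opnorm (\sum_j mxabs (B j))) ->
  opnorm (funcalc f (mxabs (\sum_j A j))) <=
  c * opnorm (\sum_j funcalc f (mxabs (A j))).
Proof.
move=> n0 m0 c1 fc lin; have c0 : 0 <= c by lra.
have f0 x : 0 <= x -> 0 <= f x by case: fc => + _; exact.
have [V [sg [k [uV aS SS sg0 sgk]]]] := mxabs_top (\sum_j A j) n0.
set F := \sum_j funcalc _ _.
have FS : opnorm (funcalc f (mxabs (\sum_j A j))) <= f (sg k).
  rewrite aS (funcalc_spec _ _ uV); apply: opnorm_spec_le => //=.
  - by move=> l; exact: f0.
  - by move=> l; apply: (concave_nondecreasing fc).
  - exact: f0.
apply: le_trans FS _.
have qF0 j v : 0 <= qf (funcalc f (mxabs (A j))) v by exact: qf_funcalc_ge0.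
have [[j [U [d [uU aj d0 [l dl]]]]]|small] := pselect (exists j U d,
    [/\ U \is unitarymx, mxabs (A j) = spec U d, forall l, 0 <= d l &
        exists l, sg k <= d l]).
  apply: (@le_trans _ _ (opnorm F)); last by rewrite ler_peMl ?opnorm_ge0.
  apply: le_trans (qf_le_opnorm F (qf1_evec l uU)).
  rewrite /F qf_sum (bigD1 j) //= aj (funcalc_spec _ _ uU) (qf_evec _ l uU) /=.
  rewrite -[f (sg k)]addr0; apply: lerD; last by rewrite sumr_ge0.
  exact: (concave_nondecreasing fc).
have sk0 : 0 < sg k.
  have [U [d [uU aj _ d0]]] := mxabs_spec (A (Ordinal m0)).
  rewrite ltNge; apply/negP => sk; apply: small.
  exists (Ordinal m0), U, d; split=> //; exists k.
  exact: le_trans sk (d0 k).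
pose kap := f (sg k) / sg k.
have kap0 : 0 <= kap by rewrite divr_ge0 ?f0.
have dom v : kap * qf (\sum_j mxabs (A j)) v <= qf F v.
  rewrite !qf_sum mulr_sumr; apply: ler_sum => j _.
  have [U [d [uU aj _ d0]]] := mxabs_spec (A j).
  rewrite aj (funcalc_spec _ _ uU) !qf_spec mulr_sumr; apply: ler_sum => l _ /=.
  rewrite mulrA ler_wpM2r ?sqm_ge0 //.
  have dsk : d l <= sg k.
    rewrite leNgt; apply/negP => lt; apply: small.
    by exists j, U, d; split=> //; exists l; exact: ltW.
  by rewrite /kap mulrAC ler_pdivrMr // mulrC [f (d l) * _]mulrC (concave_ratio fc).
have [|v|W [t [uW TE t0]]] := @psd_spec _ _ (\sum_j mxabs (A j)).
- by rewrite adj_sum; apply: eq_bigr => j _; exact: mxabs_adj.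
- by rewrite qf_sum sumr_ge0 // => j _; exact: qf_mxabs_ge0.
have Tle : kap * opnorm (\sum_j mxabs (A j)) <= opnorm F.
  pose k' := [arg max_(i > Ordinal n0) t i]%O.
  have tk l : t l <= t k' by rewrite /k'; case: arg_maxP => // i _; exact.
  apply: (@le_trans _ _ (kap * t k')).
    by rewrite ler_wpM2l // TE; apply: opnorm_spec_le.
  apply: le_trans (qf_le_opnorm F (qf1_evec k' uW)).
  by rewrite -(qf_evec t k' uW) -TE dom.
have Sge : sg k <= opnorm (\sum_j A j).
  have e1 : qf 1%:M (evec V k) <= 1 by rewrite (qf1_evec k uV).
  apply: (le_trans _ (opnorm_ge _ e1)).
  by rewrite -qf_gram SS (qf_evec _ k uV) sqrtr_sqr ger0_norm.
have -> : f (sg k) = kap * sg k by rewrite /kap divfK // gt_eqF.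
apply: le_trans (ler_wpM2l kap0 (le_trans Sge (lin A))) _.
by rewrite mulrCA; exact: (ler_wpM2l c0 Tle).
Qed.

End OperatorNorm.

(** * Schatten norms and the theorem *)

Section Schatten.
Context {R : realType}.
Local Notation C := R[i].

Lemma schatten_fin n (r : R) (A : 'M[C]_n) : schatten r%:E A = trp r A `^ r^-1.
Proof. by []. Qed.

Lemma schatten_ge0 n (p : \bar R) (A : 'M[C]_n) : 0 <= schatten p A.
Proof. by case: p => [r| |] //=; [rewrite powR_ge0|exact: opnorm_ge0]. Qed.

Lemma ex_ge1 (p : \bar R) : (1 <= p)%E -> (exists2 r, p = r%:E & 1 <= r) \/ p = +oo%E.
Proof.
case: p => [r| |]; [rewrite lee_fin => r1; left; exists r| right|] => //.
Qed.

Lemma funcalc_id n (A : 'M[C]_n) : funcalc id (mxabs A) = mxabs A.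
Proof. by have [U [d [_ -> -> _ _]]] := funcalc_mxabs id A. Qed.

Lemma concave_id : concave_nneg (id : R -> R).
Proof.
split=> // t x y _ _.
by rewrite le_eqVlt; apply/orP; left; apply/eqP; rewrite !convRE opprD !mulrN.
Qed.

Lemma schatten_mxabs n (p : \bar R) (A : 'M[C]_n) : schatten p (mxabs A) = schatten p A.
Proof.
case: p => [r| |]; [|exact: opnorm_mxabs|by []].
have [U [d [uU aA _ d0]]] := mxabs_spec A.
have aaA : mxabs (mxabs A) = mxabs A by rewrite aA; exact: mxabs_psd.
by rewrite !schatten_fin /trp aaA.
Qed.

Lemma schatten_eq0 n (p : \bar R) (P : 'M[C]_n) : (1 <= p)%E ->
  P^t* = P -> (forall v, 0 <= qf P v) -> schatten p P = 0 -> forall v, qf P v = 0.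
Proof.
move=> /ex_ge1 p1 Ph P0 N0; have [U [d [uU PE d0]]] := psd_spec Ph P0.
suff dz k : d k = 0 by move=> v; rewrite PE qf_spec big1 // => k _; rewrite dz mul0r.
case: p1 N0 => [[r -> r1]|->].
  have r0 : r != 0 by rewrite gt_eqF //; lra.
  rewrite schatten_fin PE trp_spec // => /powR_eq0_eq0 /eqP.
  rewrite psumr_eq0 => [/allP z|i _]; last exact: powR_ge0.
  by have /eqP/powR_eq0_eq0 := z k (mem_index_enum k).
move=> N0; apply/eqP; rewrite eq_le d0 andbT -(qf_evec d k uU) -PE.
by rewrite -[X in _ <= X]N0; apply: qf_le_opnorm; exact: qf1_evec.
Qed.

Lemma schatten0 n (p : \bar R) : (1 <= p)%E -> schatten p (0 : 'M[C]_n) = 0.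
Proof.
have u1 : (1%:M : 'M[C]_n) \is unitarymx.
  by apply/unitarymxP; rewrite adj1 mulmx1.
case/ex_ge1 => [[r -> r1]|->].
  have r0 : r != 0 by rewrite gt_eqF //; lra.
  rewrite schatten_fin -(spec0 1%:M) trp_spec // big1 => [|k _]; rewrite powR0 //.
  by rewrite invr_eq0.
apply/eqP; rewrite eq_le [X in _ && X]opnorm_ge0 andbT.
by rewrite -(spec0 1%:M); apply: opnorm_spec_le.
Qed.

Lemma schatten1_neq0 n (p : \bar R) : (0 < n)%N -> (1 <= p)%E ->
  schatten p (1%:M : 'M[C]_n) != 0.
Proof.
move=> n0 p1; apply/eqP => N0.
have u1 : (1%:M : 'M[C]_n) \is unitarymx.
  by apply/unitarymxP; rewrite adj1 mulmx1.
have := schatten_eq0 p1 (adj1 n) (@qf1_ge0 _ n) N0 (evec 1%:M (Ordinal n0)).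
by rewrite qf1_evec // => /eqP; rewrite oner_eq0.
Qed.

Lemma schatten_lin_concave n m (p : \bar R) (c : R) (f : R -> R)
    (A : 'I_m -> 'M[C]_n) : (0 < n)%N -> (0 < m)%N -> (1 <= p)%E -> 1 <= c ->
  concave_nneg f ->
  (forall B : 'I_m -> 'M[C]_n,
     schatten p (\sum_j B j) <= c * schatten p (\sum_j mxabs (B j))) ->
  schatten p (funcalc f (mxabs (\sum_j A j))) <=
  c * schatten p (\sum_j funcalc f (mxabs (A j))).
Proof.
move=> n0 m0 /ex_ge1 [[r -> r1]|->] c1 fc lin; last exact: concave_bound_inf.
have r0 : 0 < r by lra.
have c0 : 0 <= c by lra.
have conv (X Y : 'M[C]_n) : (schatten r%:E X <= c * schatten r%:E Y) =
    (trp r X <= c `^ r * trp r Y).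
  have XE (Z : 'M[C]_n) : trp r Z = schatten r%:E Z `^ r.
    by rewrite schatten_fin -powRrM mulVf ?gt_eqF // powRr1 // trp_ge0.
  rewrite !XE -powRM ?schatten_ge0 //.
  have cY : 0 <= c * schatten r%:E Y by rewrite mulr_ge0 ?schatten_ge0.
  apply/idP/idP => [h|].
    by apply: ge0_ler_powR; rewrite ?nnegrE ?schatten_ge0 // ltW.
  apply: contraTT; rewrite -!ltNge => h.
  by apply: gt0_ltr_powR; rewrite ?nnegrE ?schatten_ge0.
rewrite conv; apply: concave_bound => //; last by move=> B; rewrite -conv.
rewrite -(powRr0 c); apply: ler_powR => //; exact: ltW.
Qed.

(** This is the case of a zero denominator.  All f(X_j) vanish, so either f
    vanishes at some point x > 0, hence on [0, +oo[ by concavity, or all A_j are 0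
    and f(0) = 0. *)
Lemma funcalc_sum_eq0 n m (p : \bar R) (f : R -> R) (A : 'I_m -> 'M[C]_n) :
  (0 < n)%N -> (0 < m)%N -> (1 <= p)%E -> concave_nneg f ->
  schatten p (\sum_j funcalc f (mxabs (A j))) = 0 ->
  funcalc f (mxabs (\sum_j A j)) = 0.
Proof.
move=> n0 m0 p1 fc N0.
have f0 x : 0 <= x -> 0 <= f x by case: fc => + _; exact.
have q0 j v : 0 <= qf (funcalc f (mxabs (A j))) v by exact: qf_funcalc_ge0.
have sumh : (\sum_j funcalc f (mxabs (A j)))^t* = \sum_j funcalc f (mxabs (A j)).
  by rewrite adj_sum; apply: eq_bigr => j _; exact: funcalc_adj.
have sum0 v : 0 <= qf (\sum_j funcalc f (mxabs (A j))) v.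
  by rewrite qf_sum sumr_ge0.
have z j v : qf (funcalc f (mxabs (A j))) v = 0.
  have /eqP := schatten_eq0 p1 sumh sum0 N0 v; rewrite qf_sum psumr_eq0 // => /allP z.
  by apply/eqP/z; rewrite mem_index_enum.
have fd j : exists U d, [/\ U \is unitarymx, (A j)^t* *m A j = spec U (fun k => d k ^+ 2),
    forall k, 0 <= d k & forall k, f (d k) = 0].
  have [U [d [uU _ FE AA d0]]] := funcalc_mxabs f (A j).
  by exists U, d; split=> // k; rewrite -(z j (evec U k)) FE (qf_evec _ k uU).
have [V [s [uV _ -> SS s0]]] := funcalc_mxabs f (\sum_j A j).
rewrite -(spec0 V); apply: eq_spec => k /=.
have [[x [x0 fx0]]|nopos] := pselect (exists x, 0 < x /\ f x = 0).
  apply/eqP; rewrite eq_le f0 // andbT; have [sx|xs] := leP (s k) x.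
    by rewrite -fx0; apply: (concave_nondecreasing fc).
  have := concave_ratio fc (ltW x0) (ltW xs).
  by rewrite fx0 mulr0 pmulr_rle0.
have A0 j : A j = 0.
  have [U [d [uU AA d0 fd0]]] := fd j.
  apply: gram_eq0; rewrite AA -(spec0 U); apply: eq_spec => l.
  have -> : d l = 0; last by rewrite expr0n.
  apply/eqP; rewrite eq_le d0 andbT leNgt; apply/negP => dl.
  by apply: nopos; exists (d l).
have [U [d [uU AA d0 fd0]]] := fd (Ordinal m0).
have zero : f 0 = 0.
  have := fd0 (Ordinal n0); suff -> : d (Ordinal n0) = 0 by [].
  apply/eqP; rewrite eq_le d0 andbT leNgt; apply/negP => dl.
  by apply: nopos; exists (d (Ordinal n0)).
have -> : s k = 0; last exact: zero.
apply/eqP; rewrite -sqrf_eq0; apply/eqP.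
rewrite -(qf_evec (fun k => s k ^+ 2) k uV) -SS big1 => [|j _]; last exact: A0.
by rewrite adj0 mul0mx qf0.
Qed.

End Schatten.

Theorem theorem1p1 (R : realType) (m n : nat) (p : \bar R)
  (hm : (1 <= m)%N) (hn : (1 <= n)%N) (hp : (1 <= p)%E) :
  [/\ c_conc p m n = c_lin p m n,
      forall (f : R -> R) (A : 'I_m -> 'M[R[i]]_n), concave_nneg f ->
        ((schatten p (funcalc f (mxabs (\sum_j A j))))%:E <=
         c_lin p m n * (schatten p (\sum_j funcalc f (mxabs (A j))))%:E)%E
    & forall c : R, (c%:E < c_lin p m n)%E ->
        ~ (forall (f : R -> R) (A : 'I_m -> 'M[R[i]]_n), concave_nneg f ->
             schatten p (funcalc f (mxabs (\sum_j A j))) <=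
             c * schatten p (\sum_j funcalc f (mxabs (A j))))].
Proof.
have sum_id (A : 'I_m -> 'M[R[i]]_n) :
    \sum_j funcalc id (mxabs (A j)) = \sum_j mxabs (A j).
  by apply: eq_bigr => j _; exact: funcalc_id.
have c1 : (1 <= c_lin p m n)%E.
  pose j0 := Ordinal hm.
  (* the ratio is 1 when one A_j is the identity and the others are 0 *)
  pose A (j : 'I_m) : 'M[R[i]]_n := if j == j0 then 1%:M else 0.
  have u1 : (1%:M : 'M[R[i]]_n) \is unitarymx.
    by apply/unitarymxP; rewrite adj1 mulmx1.
  have E1 : \sum_j A j = 1%:M.
    rewrite (bigD1 j0) //= big1 ?addr0 => [|j jj0]; rewrite /A ?eqxx //.
    by rewrite (negPf jj0).
  have a1 : mxabs (1%:M : 'M[R[i]]_n) = 1%:M.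
    by rewrite -(spec1 u1); apply: mxabs_psd.
  have a0 : mxabs (0 : 'M[R[i]]_n) = 0.
    by rewrite -(spec0 1%:M); apply: mxabs_psd.
  have E2 : \sum_j mxabs (A j) = 1%:M.
    rewrite (bigD1 j0) //= big1 ?addr0 => [|j jj0]; rewrite /A ?eqxx //.
    by rewrite (negPf jj0).
  apply: ereal_sup_ubound; exists A => /=; rewrite ?E1 ?E2.
    exact: schatten1_neq0.
  by rewrite divff // schatten1_neq0.
have lin c : c_lin p m n = c%:E -> forall B : 'I_m -> 'M[R[i]]_n,
    schatten p (\sum_j B j) <= c * schatten p (\sum_j mxabs (B j)).
  move=> cE B; have [N0|N0] := eqVneq (schatten p (\sum_j mxabs (B j))) 0.
    rewrite N0 mulr0 -schatten_mxabs -funcalc_id.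
    rewrite -sum_id in N0.
    by rewrite (funcalc_sum_eq0 hn hm hp concave_id N0) (schatten0 n hp).
  have Npos : 0 < schatten p (\sum_j mxabs (B j)) by rewrite lt_def N0 schatten_ge0.
  rewrite -ler_pdivrMr // -lee_fin -cE.
  by apply: ereal_sup_ubound; exists B.
have bound f (A : 'I_m -> 'M[R[i]]_n) : concave_nneg f ->
    ((schatten p (funcalc f (mxabs (\sum_j A j))))%:E <=
     c_lin p m n * (schatten p (\sum_j funcalc f (mxabs (A j))))%:E)%E.
  move=> fc; have [N0|N0] := eqVneq (schatten p (\sum_j funcalc f (mxabs (A j)))) 0.
    by rewrite N0 mule0 (funcalc_sum_eq0 hn hm hp fc N0) (schatten0 n hp).
  have Npos : 0 < schatten p (\sum_j funcalc f (mxabs (A j))).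
    by rewrite lt_def N0 schatten_ge0.
  case cE : (c_lin p m n) c1 (lin) => [c| |] c1' lin'.
  - rewrite -EFinM lee_fin; apply: schatten_lin_concave => //.
    exact: lin'.
  - by rewrite gt0_mulye ?lte_fin // leey.
  - by move: c1'; rewrite leNgt ltNye.
split=> //.
- apply/eqP; rewrite eq_le; apply/andP; split.
    apply: ge_ereal_sup => _ [[f A] /= [fc N0] <-].
    have Npos : 0 < schatten p (\sum_j funcalc f (mxabs (A j))).
      by rewrite lt_def N0 schatten_ge0.
    have := bound f A fc; case: (c_lin p m n) => [c| |].
    + by rewrite -EFinM !lee_fin ler_pdivrMr.
    + by rewrite leey.
    + by rewrite gt0_mulNye ?lte_fin // leNgt ltNye.
  apply: le_ereal_sup => _ [A /= N0 <-]; exists (id, A) => /=.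
    by split; [exact: concave_id|rewrite sum_id].
  by rewrite sum_id funcalc_id schatten_mxabs.
- move=> c /ereal_sup_gt[_ [A /= N0 <-]]; rewrite lte_fin => cA H.
  have Npos : 0 < schatten p (\sum_j mxabs (A j)) by rewrite lt_def N0 schatten_ge0.
  have := H id A concave_id; rewrite sum_id funcalc_id schatten_mxabs.
  by rewrite -ler_pdivrMr // leNgt cA.
Qed.
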